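(* Let $n$ and $r\geq 0$ be integers and let $G\in\mathcal{U}_{n,r}$ be such that $W(G)$ is minimum among all graphs in $\mathcal{U}_{n,r}$. Then: (1) if $r\leq 2$, then $G$ must be $H(SB(1;b_1),X_1,X_2)$, where $X_j\in\{K_1,K_2\}$ for each $j=1,2$ and $b_1$ is odd; (2) if $r\geq 3$, then $G$ must be $H(K_2,K_1,K_1,K_1,K_1)$ or $H(SaB(t;b_2),K_1,\dots,K_1)$, where $b_2\geq 0$ is even and $t\geq 0$.
   Context: All graphs are finite and simple. For a connected graph $G$, the Wiener index is $W(G)=\sum_{\{u,v\}\subseteq V(G)} d(u,v)$, the sum of distances over all unordered pairs of distinct vertices. A graph is unicyclic if it is connected and contains exactly one cycle. $\mathcal{U}_{n,r}$ denotes the set of unicyclic graphs with $n$ vertices of which exactly $r$ have even degree. If $G$ is unicyclic with cycle $C=v_1v_2\dots v_\ell v_1$, then each component of $G-E(C)$ is a tree $T_i$ containing exactly one cycle vertex $v_i$, regarded as rooted at $v_i$; one writes $G=H(T_1,T_2,\dots,T_\ell)$ (the trees listed in cyclic order around the cycle, each $T_i$ attached to the cycle at its root). $K_1$ denotes a single vertex (so $d_G(v_i)=2$), and $K_2$ a single edge rooted at one of its endpoints (a pendant edge). A subdivided star with center $u$ is a tree obtained from a star with center $u$ by inserting degree-2 vertices into its edges; its branches are the paths from $u$ to its leaves, and the length of a branch is its number of edges. $SB(t;b)$ (balanced subdivided star) is the subdivided star with $b$ branches each of length exactly $t$; $SaB(t;b)$ (almost balanced subdivided star) is a subdivided star with $b$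 branches, each of length $t$ or $t-1$, at least one of length $t$. Conventions: $SB(1;1)=K_2$, $SB(0;0)=K_1$, and $SB(1;b)$ is the star with $b$ leaves. When such a star appears as an argument of $H$, it is rooted at its center. *)

(* Defs.v *)
From mathcomp Require Import all_boot.

Set Implicit Arguments.
Unset Strict Implicit.
Unset Printing Implicit Defensive.

Record sgraph := SGraph {
  vertex :> finType;
  adj : rel vertex;
  adj_sym : symmetric adj;
  adj_irr : irreflexive adj }.
Arguments adj {s} : rename.

Definition isomorphic (G H : sgraph) : Prop :=
  exists2 f : G -> H, bijective f & forall x y, adj (f x) (f y) = adj x y.

Definition connected (G : sgraph) : Prop := forall u v : G, connect adj u v.

(* The least length of a walk from u to v. A shortest walk has fewer than #|G|
   edges, so the bounded search is exhaustive; it returns the junk value #|G|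
   when u and v lie in different components. *)
Definition dist (G : sgraph) (u v : G) : nat :=
  find (fun k => [exists p : k.-tuple G, path adj u p && (last u p == v)])
       (iota 0 #|G|).

(* The comparison of ranks selects each unordered pair {u, v} exactly once. *)
Definition wiener (G : sgraph) : nat :=
  \sum_(u : G) \sum_(v : G | enum_rank u < enum_rank v) dist u v.

Definition degree (G : sgraph) (v : G) : nat := #|[set w | adj v w]|.

Definition is_cycle (G : sgraph) (c : seq G) : Prop :=
  ucycle adj c /\ 3 <= size c.

(* A cycle, as a subgraph, is determined by its edge set; this identifies the
   sequences that differ by a rotation or a reversal. *)
Definition cycle_edges (G : sgraph) (c : seq G) : {set {set G}} :=
  [set [set x; next c x] | x in c].

Definition unicyclic (G : sgraph) : Prop :=
  [/\ connected G,
      exists c : seq G, is_cycle c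
    & forall c1 c2 : seq G,
        is_cycle c1 -> is_cycle c2 -> cycle_edges c1 = cycle_edges c2].

Definition in_U (n r : nat) (G : sgraph) : Prop :=
  [/\ unicyclic G, #|G| = n & #|[set v : G | ~~ odd (degree v)]| = r].

Record rooted_graph := RGraph { rg_graph :> sgraph; rg_root : rg_graph }.

Lemma K1_sym : symmetric (fun _ _ : unit => false).
Proof. by []. Qed.

Lemma K1_irr : irreflexive (fun _ _ : unit => false).
Proof. by []. Qed.

Definition K1 : rooted_graph := @RGraph (SGraph K1_sym K1_irr) tt.

Lemma K2_sym : symmetric (fun x y : bool => x != y).
Proof. by move=> x y; rewrite eq_sym. Qed.

Lemma K2_irr : irreflexive (fun x y : bool => x != y).
Proof. by move=> x; rewrite eqxx. Qed.

Definition K2 : rooted_graph := @RGraph (SGraph K2_sym K2_irr) false.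

Section SubdividedStar.
Variable L : seq nat.

(* None is the center; Some (i, j) is the vertex at distance j + 1 from the
   center on the i-th branch, whose length is the i-th entry of L. *)
Definition star_vertex : finType :=
  option {i : 'I_(size L) & 'I_(nth 0 L i)}.

Definition star_adj (x y : star_vertex) : bool :=
  match x, y with
  | None, None => false
  | None, Some v | Some v, None => tagged v == 0 :> nat
  | Some u, Some v =>
      (tag u == tag v) &&
      (((tagged u).+1 == tagged v :> nat) || ((tagged v).+1 == tagged u :> nat))
  end.

Lemma star_adj_sym : symmetric star_adj.
Proof. by move=> [u|] [v|] //=; rewrite [tag v == _]eq_sym orbC. Qed.

Lemma star_adj_irr : irreflexive star_adj.
Proof.
move=> [u|] //=; rewrite eqxx orbb /=; apply/negbTE.
by rewrite neq_ltn ltnSn orbT.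
Qed.

Definition subdivided_star : rooted_graph :=
  @RGraph (SGraph star_adj_sym star_adj_irr) None.

End SubdividedStar.

Definition SB (t b : nat) : rooted_graph := subdivided_star (nseq b t).

(* Branches of a subdivided star have length at least 1, so for t = 1 all of
   them have length 1. Without branches there is none of length t; as for SB,
   the pair (t, b) = (0, 0) denotes the single vertex. *)
Definition is_SaB (t b : nat) (S : rooted_graph) : Prop :=
  exists L : seq nat,
    [/\ size L = b,
        forall l, l \in L -> 0 < l /\ (l = t \/ l = t - 1),
        t \in L \/ (t = 0 /\ b = 0)
      & S = subdivided_star L].

Section UnicyclicFromTrees.
Variable Ts : seq rooted_graph.

Definition H_vertex : finType := {i : 'I_(size Ts) & nth K1 Ts i}.

(* Consecutive positions in the cyclic order; ordS is i |-> i + 1 modulo the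
   length. *)
Definition cyc_adj (i j : 'I_(size Ts)) : bool :=
  (i != j) && ((ordS i == j) || (ordS j == i)).

Definition H_adj (x y : H_vertex) : bool :=
  ((tag x == tag y) && adj (tagged x) (tagged_as x y)) ||
  [&& tagged x == rg_root _, tagged y == rg_root _ & cyc_adj (tag x) (tag y)].

Lemma H_adj_sym : symmetric H_adj.
Proof.
move=> [i x] [j y]; rewrite /H_adj /cyc_adj /= [j == i]eq_sym.
rewrite [(ordS j == i) || _]orbC andbCA; congr (_ || _).
case: (eqVneq i j) => [eij|//]; case: _ / eij y => y /=.
by rewrite !tagged_asE adj_sym.
Qed.

Lemma H_adj_irr : irreflexive H_adj.
Proof.
by move=> [i x]; rewrite /H_adj /cyc_adj /= eqxx tagged_asE adj_irr /= !andbF.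
Qed.

(* The trees listed in Ts, in this cyclic order, with their roots joined into a
   cycle. Meaningful for at least three trees. *)
Definition H_of : sgraph := SGraph H_adj_sym H_adj_irr.

End UnicyclicFromTrees.

(* Main.v *)
Require Import Defs.
From mathcomp Require Import all_boot zify.

Set Implicit Arguments.
Unset Strict Implicit.
Unset Printing Implicit Defensive.

(** Let the cycle of [G] have length [l] and put [N = n - l].  Every vertex [w]
    off the cycle is the lower end of one bridge, which cuts off the [s_w]
    descendants of [w].  Counting the pairs separated by bridges and the pairs
    hanging at different cycle vertices gives
      2 W(G) = 2 sum_w s_w (n - s_w) + (l + 2 N) D_l + Z,
    where [D_l] is the transmission of a vertex of the cycle and [Z] sums the
    cycle distances between the roots of the off-cycle vertices.

    By the degree sum, both sides of a bridge contain a vertex of odd degree.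
    Smaller sides of equal size are disjoint, so at most [p = n - r] bridges have
    a smaller side of a given size.  As [s (n - s)] increases for [s <= n / 2],
    the first sum is at least its value for [p] balanced branches at one cycle
    vertex.  In the case of equality each smaller side of size [k + 1] contains
    one of size [k], which forces the branches to be paths of almost equal length.
    For [r >= 3] this settles [p <= N]; if [N < p], the bound
    [s_w (n - s_w) >= n - 1] shows that the [r]-cycle with [p] pendant vertices
    at one vertex is better, except for a tie when [n = 6].

    For [r <= 2] a cycle vertex without a tree has degree 2, so at least [l - r]
    trees are nontrivial; this bounds [Z] from below, and the same estimates
    leave only the triangle with pendant vertices. *)

(** * Walks and distances *)

Lemma dist_le (G : sgraph) (u : G) (p : seq G) :
  path adj u p -> dist u (last u p) <= size p.
Proof.
move=> up; rewrite /dist; set P := (fun k => _).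
have Pp : P (size p) by apply/existsP; exists (in_tuple p); rewrite /= up eqxx.
(* A walk with at least [#|G|] edges lies outside the searched range, but [find] never exceeds the
   length of that range. *)
have [lt_pG|le_Gp] := ltnP (size p) #|G|; last first.
  by apply: leq_trans le_Gp; rewrite -[leqRHS](size_iota 0) find_size.
rewrite leqNgt; apply/negP => /(before_find 0); rewrite nth_iota // add0n.
by rewrite Pp.
Qed.

Lemma dist_path (G : sgraph) (u v : G) : connect adj u v ->
  exists p, [/\ path adj u p, last u p = v & size p = dist u v].
Proof.
case/connectP => p up ->; case/shortenP: up => q uq Uq _.
rewrite /dist; set P := (X in find X _).
have lt_qG : size q < #|G| by have := uniq_leq_size Uq (fun x _ => mem_enum G x); rewrite -cardE.
have Pq : has P (iota 0 #|G|).
  apply/hasP; exists (size q); first by rewrite mem_iota.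
  by apply/existsP; exists (in_tuple q); rewrite /= uq eqxx.
have := nth_find 0 Pq; rewrite has_find size_iota in Pq.
rewrite nth_iota // add0n => /existsP[t /andP[ut /eqP lt]].
by exists t; rewrite size_tuple.
Qed.

Lemma dist_sym (G : sgraph) (u v : G) : connected G -> dist u v = dist v u.
Proof.
move=> cG; suff le_d x y : @dist G x y <= dist y x by apply/eqP; rewrite eqn_leq !le_d.
have [p [yp lp <-]] := dist_path (cG y x).
have := rev_path adj y p; rewrite (eq_path (e' := adj)) => [|a b]; last exact: adj_sym.
rewrite yp lp => xq; have := dist_le xq; rewrite size_rev size_belast.
have -> // : last x (rev (belast y p)) = y.
by case: p {yp xq lp} (lp) => //= a p _; rewrite rev_cons last_rcons.
Qed.

Lemma dist_refl (G : sgraph) (u : G) : dist u u = 0.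
Proof. by apply/eqP; rewrite -leqn0; apply: (@dist_le _ u [::]). Qed.

Lemma sum_dist (G : sgraph) : connected G ->
  \sum_(u : G) \sum_(v : G) dist u v = (wiener G).*2.
Proof.
move=> cG; rewrite /wiener -addnn [X in _ = _ + X](exchange_big_dep xpredT) //= -big_split /=.
apply: eq_bigr => u _; rewrite (bigID (fun v => enum_rank u < enum_rank v)) /=.
congr (_ + _); rewrite [RHS]big_mkcond [LHS]big_mkcond /=; apply: eq_bigr => v _.
rewrite -leqNgt leq_eqVlt; case: ltngtP => //= e; first by rewrite dist_sym.
by rewrite (enum_rank_inj (val_inj e)) dist_refl.
Qed.

(** * Distances on a cycle *)

Definition cdist (l i j : nat) : nat := minn (i - j + (j - i)) (l - (i - j + (j - i))).

(* The number [D_l] of the header. *)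
Definition csum (l : nat) : nat := \sum_(d < l) minn d (l - d).

Lemma modS l i : i < l -> i.+1 %% l = if i.+1 == l then 0 else i.+1.
Proof.
move=> il; case: eqP => [->|ne]; first by rewrite modnn.
by rewrite modn_small; lia.
Qed.

Lemma cdistS l i j : i < l -> j < l -> cdist l (i.+1 %% l) (j.+1 %% l) = cdist l i j.
Proof. by move=> il jl; rewrite !modS // /cdist; do 2! case: eqP => ?; lia. Qed.

(** Here [i1] is the successor and [i2] the predecessor of [i]; one of them lies on a shortest arc
    to [j]. *)
Lemma cdist_step l i j i1 i2 : i < l -> j < l -> i <> j -> i2 < l ->
    i1 = i.+1 %% l -> i = i2.+1 %% l ->
  cdist l i j = (cdist l i1 j).+1 \/ cdist l i j = (cdist l i2 j).+1.
Proof.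
move=> il jl ij i2l; rewrite !modS // /cdist.
by do 2! case: eqP => ?; move=> -> ?; lia.
Qed.

Lemma cdist_lip l i j : i < l -> j < l ->
  cdist l i j <= (cdist l (i.+1 %% l) j).+1 /\ cdist l (i.+1 %% l) j <= (cdist l i j).+1.
Proof. by move=> il jl; rewrite modS // /cdist; case: eqP => ?; lia. Qed.

Lemma cdist_gt0 l i j : i < l -> j < l -> i <> j -> 0 < cdist l i j.
Proof. by rewrite /cdist; lia. Qed.

(** Rotation by [ordS] preserves [cdist], so all positions have the transmission of position 0. *)
Lemma sum_cdist l (i : 'I_l) : \sum_(j < l) cdist l i j = csum l.
Proof.
case: i => i /=; elim: i => [|i IHi] il.
  by apply: eq_bigr => j _; rewrite /cdist; lia.
rewrite -(IHi (ltnW il)) (reindex_inj (@ordS_inj l)) /=.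
apply: eq_bigr => j _; rewrite -{1}(@modn_small i.+1 l) //.
by rewrite cdistS // ltnW.
Qed.

(** The first term is 0, the last is 1, and each of the [l] others exceeds a term of [csum l] by
    1. *)
Lemma csumSS l : csum l.+2 = csum l + l.+1.
Proof.
rewrite /csum big_ord_recl min0n add0n big_ord_recr /= /bump /=.
rewrite (eq_bigr (fun d : 'I_l => minn d (l - d) + 1)) => [|d _]; last first.
  by have := ltn_ord d; rewrite /bump /=; lia.
by rewrite big_split /= sum_nat_const card_ord; lia.
Qed.

Lemma csumE l : 4 * csum l + odd l = l * l.
Proof.
elim/ltn_ind: l => [[|[|l]]] IH; first by rewrite /csum big_ord0.
  by rewrite /csum big_ord1.
by have := IH l (ltnW (leqnn _)); rewrite csumSS /= negbK; nia.
Qed.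

(** * Unicyclic graphs as cycles with attached trees *)

Section Presentation.
Variables (V : finType).
Implicit Types (c : seq V) (par : V -> V) (h : V -> nat).

Definition cadj c : rel V := fun u v =>
  [&& u \in c, v \in c & (v == next c u) || (u == next c v)].

Definition padj c par : rel V := fun u v =>
  [|| cadj c u v, (u \notin c) && (v == par u) | (v \notin c) && (u == par v)].

(* The graph [a] consists of the cycle [c] and of an edge from each vertex [x] off
   [c] to [par x]; the rank [h] ensures that iterating [par] ends on the cycle. *)
Record presentation (a : rel V) c par h : Prop := Presentation {
  pres_uniq : uniq c;
  pres_size : 2 < size c;
  pres_par : {in c, forall x, par x = x};
  pres_rank : forall x, x \notin c -> h (par x) < h x;
  pres_adj : a =2 padj c par }.

Definition desc par (w : V) : {set V} := [set u | fconnect par u w].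
(* Once on the cycle, [par] does not move, so [h u] iterations reach the root. *)
Definition rt par h u : V := iter (h u) par u.
Definition dcyc c (x y : V) := cdist (size c) (index x c) (index y c).

Lemma cadj_sym c : symmetric (cadj c).
Proof. by move=> u v; rewrite /cadj andbCA orbC. Qed.

Lemma padj_sym c par : symmetric (padj c par).
Proof. by move=> u v; rewrite /padj cadj_sym [X in _ || X]orbC. Qed.

Lemma index_next c x : uniq c -> x \in c ->
  index (next c x) c = (index x c).+1 %% size c.
Proof.
move=> Uc xc; rewrite next_nth xc; case: c Uc xc => // y p Uc xc.
have lt_x := xc; rewrite -index_mem in lt_x.
(* At the last position the lookup in the tail runs off its end; the default [y], the head of the
   cycle, is the wrap-around. *)
rewrite modS //; case: eqP => [e|ne].
  by rewrite nth_default /= ?eqxx //; move: e => [<-].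
have -> : nth y p (index x (y :: p)) = nth y (y :: p) (index x (y :: p)).+1 by [].
by rewrite index_uniq // ltn_neqAle lt_x andbT; apply/eqP.
Qed.

Lemma next_neq c x : uniq c -> 1 < size c -> x \in c -> next c x != x.
Proof.
move=> Uc sc xc; apply/eqP => e; have := index_next Uc xc; rewrite e.
have := xc; rewrite -index_mem => ?; by rewrite modS //; case: eqP => ? ?; lia.
Qed.

Section Theory.
Variables (a : rel V) (c : seq V) (par : V -> V) (h : V -> nat).
Hypothesis P : presentation a c par h.
Let Uc := pres_uniq P.
Let sc := pres_size P.
Local Notation desc := (desc par).
Local Notation rt := (rt par h).
Local Notation dcyc := (dcyc c).

Lemma pres_sym : symmetric a.
Proof. by move=> u v; rewrite !(pres_adj P) padj_sym. Qed.

Lemma par_adj u : u \notin c -> a u (par u).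
Proof. by move=> uc; rewrite (pres_adj P) /padj uc eqxx /= orbT. Qed.

Lemma next_adj u : u \in c -> a u (next c u).
Proof. by move=> uc; rewrite (pres_adj P) /padj /cadj mem_next uc eqxx. Qed.

Lemma rank_par u : h (par u) <= h u.
Proof.
have [uc|uc] := boolP (u \in c); first by rewrite (pres_par P).
by rewrite ltnW ?(pres_rank P).
Qed.

(** Induction from the cycle outwards along the trees; it is well founded because [par] lowers the
    rank. *)
Lemma par_ind (Q : V -> Prop) :
  (forall u, u \in c -> Q u) -> (forall u, u \notin c -> Q (par u) -> Q u) ->
  forall u, Q u.
Proof.
move=> Qc Qp u; have [m] := ubnP (h u); elim: m u => // m IHm u lt_um.
have [/Qc//|uc] := boolP (u \in c).
by apply: Qp (uc) (IHm _ _); have := pres_rank P uc; lia.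
Qed.

Lemma desc_refl w : w \in desc w. Proof. by rewrite inE connect0. Qed.

Lemma descE u w : (u \in desc w) = (u == w) || (par u \in desc w).
Proof. by rewrite !inE fconnect_eqVf. Qed.

Lemma descW u w : par u \in desc w -> u \in desc w.
Proof. by rewrite [u \in _]descE orbC => ->. Qed.

Lemma desc_trans u v w : u \in desc v -> v \in desc w -> u \in desc w.
Proof. by rewrite !inE; apply: connect_trans. Qed.

Lemma descP u w : reflect (exists k, iter k par u = w) (u \in desc w).
Proof.
rewrite inE; apply: (iffP idP) => [/iter_findex e|[k <-]]; last exact: fconnect_iter.
by exists (findex par u w).
Qed.

Lemma desc_cyc u w : u \in c -> w \notin c -> u \notin desc w.
Proof.
move=> uc; apply: contra => /descP[k <-].
by elim: k => //= k IHk; rewrite (pres_par P).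
Qed.

Lemma desc_ncyc u w : w \notin c -> u \in desc w -> u \notin c.
Proof. by move=> wc; apply: contraL => uc; apply: desc_cyc. Qed.

Lemma rank_desc u w : u \in desc w -> h w <= h u.
Proof.
case/descP => k <-; elim: k => //= k IHk; exact: leq_trans (rank_par _) IHk.
Qed.

Lemma par_notin_desc u : u \notin c -> par u \notin desc u.
Proof.
by move=> uc; apply/negP => /rank_desc; rewrite leqNgt (pres_rank P).
Qed.

Lemma desc_anti u w : u \notin c -> u \in desc w -> w \in desc u -> u = w.
Proof.
move=> uc; rewrite (descE u w) => /orP[/eqP//|puw wu].
by have := desc_trans puw wu; rewrite (negPf (par_notin_desc uc)).
Qed.

(** Both [v] and [w] lie on the single [par]-orbit of [u]. Hence descendant sets that meet are
    nested. *)
Lemma desc_total u v w : u \in desc v -> u \in desc w -> v \in desc w \/ w \in desc v.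
Proof.
case/descP => k <- /descP[m <-].
have [le_km|/ltnW le_mk] := leqP k m; [left|right]; apply/descP.
  by exists (m - k); rewrite -iterD subnK.
by exists (k - m); rewrite -iterD subnK.
Qed.

Lemma desc_subset u w : u \in desc w -> desc u \subset desc w.
Proof. by move=> uw; apply/subsetP => v vu; apply: desc_trans uw. Qed.

Lemma rt_c u : u \in c -> rt u = u.
Proof. by move=> uc; rewrite /rt; elim: (h u) => //= k ->; rewrite (pres_par P). Qed.

Lemma iter_par k u : h u <= k -> iter k par u = rt u.
Proof.
elim/par_ind: u k => u uc.
  by move=> k _; rewrite rt_c //; elim: k => //= k ->; rewrite (pres_par P).
move=> IH [|k] le_uk; first by have := pres_rank P uc; lia.
have hu := pres_rank P uc; rewrite iterSr IH; last lia.
by rewrite {2}/rt; case: (h u) hu => // m hm; rewrite iterSr IH; last lia.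
Qed.

Lemma rt_par u : rt (par u) = rt u.
Proof.
have [uc|uc] := boolP (u \in c); first by rewrite (pres_par P).
have hu := pres_rank P uc; rewrite -[RHS](@iter_par (h u).+1) // iterSr.
by rewrite iter_par; last lia.
Qed.

Lemma rt_mem u : rt u \in c.
Proof.
elim/par_ind: u => u uc; first by rewrite rt_c.
by rewrite rt_par.
Qed.

(* The bridge above [w] separates [u] from [v] iff exactly one of them descends
   from [w]. *)
Definition sep u v : {set V} := [set w | (w \notin c) && ((u \in desc w) (+) (v \in desc w))].
(** The closed form of the distance ([dist_delta]): a shortest path crosses each separating bridge
    once and follows the cycle between the two roots. *)
Definition delta u v : nat := #|sep u v| + dcyc (rt u) (rt v).

Lemma sep_sym u v : sep u v = sep v u.
Proof. by apply/setP => w; rewrite !inE addbC. Qed.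

Lemma dcyc_sym x y : dcyc x y = dcyc y x.
Proof. by rewrite /dcyc /cdist addnC. Qed.

Lemma delta_sym u v : delta u v = delta v u.
Proof. by rewrite /delta sep_sym dcyc_sym. Qed.

Lemma sep_cyc u u' v : u \in c -> u' \in c -> sep u v = sep u' v.
Proof.
move=> uc u'c; apply/setP => w; rewrite !in_set; case: (boolP (w \in c)) => //= wc.
have := desc_cyc uc wc; have := desc_cyc u'c wc; rewrite !in_set.
by move=> /negbTE-> /negbTE->.
Qed.

(** Passing from [u] to [par u] crosses only the bridge above [u]. The Boolean summands record the
    side of [v] and avoid subtraction. *)
Lemma sep_par_in u v : u \notin c ->
  #|sep u v| + (v \in desc u) = #|sep (par u) v| + (v \notin desc u).
Proof.
move=> uc; rewrite (cardsD1 u (sep u v)) (cardsD1 u (sep (par u) v)).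
have -> : sep u v :\ u = sep (par u) v :\ u.
  apply/setP => w; rewrite !in_setD1 ![w \in sep _ _]in_set.
  by rewrite (descE u) (eq_sym u); case: eqVneq.
rewrite ![u \in sep _ _]in_set uc /= desc_refl (negPf (par_notin_desc uc)) /=.
by case: (v \in desc u) => /=; lia.
Qed.

Lemma delta_par u v : u \notin c -> v \notin desc u -> delta u v = (delta (par u) v).+1.
Proof.
by move=> uc vu; have := sep_par_in v uc; rewrite /delta rt_par (negPf vu) /=; lia.
Qed.

Lemma delta_cyc_step u v : u \in c -> v \in c -> u != v ->
  exists2 u', a u u' & delta u v = (delta u' v).+1.
Proof.
move=> uc vc uv.
have iu := uc; rewrite -index_mem in iu; have iv := vc; rewrite -index_mem in iv.
have niuv : index u c <> index v c.
  by move=> e; case/eqP: uv; rewrite -(nth_index u uc) e nth_index.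
pose u1 := next c u; pose u2 := prev c u.
have u1c : u1 \in c by rewrite mem_next.
have u2c : u2 \in c by rewrite mem_prev.
have i1 : index u1 c = (index u c).+1 %% size c by apply: index_next.
have i2 : index u c = (index u2 c).+1 %% size c by rewrite -index_next ?next_prev.
have j2 := u2c; rewrite -index_mem in j2.
have a1 : a u u1 by apply: next_adj.
have a2 : a u u2 by rewrite pres_sym -[X in a _ X](next_prev Uc u); apply: next_adj.
have [e|ne] := cdist_step iu iv niuv j2 i1 i2.
  by exists u1 => //; rewrite /delta (sep_cyc v uc u1c) !rt_c // /dcyc e addnS.
by exists u2 => //; rewrite /delta (sep_cyc v uc u2c) !rt_c // /dcyc ne addnS.
Qed.

(** A cycle edge changes only the cycle distance, a bridge only the set [sep], each by at most one.
    This makes [delta] a lower bound for the length of walks. *)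
Lemma delta_lip u u' v : a u u' -> delta u v <= (delta u' v).+1.
Proof.
rewrite (pres_adj P) /padj /cadj => /or3P[/and3P[uc u'c]|/andP[uc /eqP->]|/andP[uc /eqP->]].
- rewrite /delta (sep_cyc v uc u'c) (rt_c uc) (rt_c u'c) /dcyc.
  have := uc; rewrite -index_mem; have := u'c; rewrite -index_mem.
  have := rt_mem v; rewrite -index_mem.
  move=> vl u'l ul /orP[]/eqP->; rewrite index_next // -addnS leq_add2l.
    by have [] := cdist_lip ul vl.
  by have [] := cdist_lip u'l vl.
- by have := sep_par_in v uc; rewrite /delta rt_par; case: (v \in desc u) => /=; lia.
by have := sep_par_in v uc; rewrite /delta rt_par; case: (v \in desc u') => /=; lia.
Qed.

Lemma delta_refl u : delta u u = 0.
Proof.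
rewrite /delta /dcyc /cdist subnn min0n addn0; apply/eqP; rewrite cards_eq0.
by apply/eqP/setP => w; rewrite !in_set addbb andbF.
Qed.

Lemma path_delta u p : path a u p -> delta u (last u p) <= size p.
Proof.
elim: p u => [|v p IHp] u /=; first by rewrite delta_refl.
case/andP => /(@delta_lip _ _ (last v p)) le_u /IHp le_v.
exact: leq_trans le_u _.
Qed.

(** Move [u] to its parent if [v] is not below it, or [v] to its parent if [u] is not below it.
    Distinct vertices that allow neither move are both on the cycle, where [delta_cyc_step]
    applies. *)
Lemma delta_path u v : exists p, [/\ path a u p, last u p = v & size p = delta u v].
Proof.
have [m] := ubnP (delta u v); elim: m u v => // m IHm u v lt_m.
have [<-|uv] := eqVneq u v; first by exists [::]; rewrite delta_refl.
have [/andP[uc vu]|nu] := boolP ((u \notin c) && (v \notin desc u)).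
  have e := delta_par uc vu; have [|p [up lp sp]] := IHm (par u) v; first lia.
  by exists (par u :: p); rewrite /= par_adj // sp e.
have [/andP[vc vu]|nv] := boolP ((v \notin c) && (u \notin desc v)).
  have e := delta_par vc vu; rewrite delta_sym in e.
  have [|p [up lp sp]] := IHm u (par v); first by rewrite delta_sym; lia.
  exists (rcons p v); rewrite rcons_path up lp pres_sym par_adj // last_rcons.
  by rewrite size_rcons sp delta_sym e.
have [uc|uc] := boolP (u \in c); last first.
  move: nu; rewrite uc negbK => vu; have vc := desc_ncyc uc vu.
  move: nv; rewrite vc negbK => uv'.
  by rewrite (desc_anti uc uv' vu) eqxx in uv.
have [vc|vc] := boolP (v \in c); last by move: nv; rewrite vc negbK (negPf (desc_cyc uc vc)).
have [u' auu' e] := delta_cyc_step uc vc uv.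
have [|p [up lp sp]] := IHm u' v; first lia.
by exists (u' :: p); rewrite /= auu' sp e.
Qed.

End Theory.
End Presentation.

(** * Wiener index, degrees and cycles of a graph with a presentation *)

Lemma sum_xor (T : finType) (S : {set T}) :
  \sum_(u : T) \sum_(v : T) ((u \in S) (+) (v \in S)) = (#|S| * (#|T| - #|S|)).*2.
Proof.
have cC : #|~: S| = #|T| - #|S| by rewrite cardsCs setCK.
have E b : \sum_(v : T) (b (+) (v \in S)) = if b then #|T| - #|S| else #|S|.
  rewrite -cC -!sum1_card; case: b; rewrite [RHS]big_mkcond; apply: eq_bigr => v _.
    by rewrite inE; case: (v \in S).
  by case: (v \in S).
rewrite (eq_bigr _ (fun u _ => E (u \in S))) (bigID (mem S)) /=.
rewrite (eq_bigr (fun _ => #|T| - #|S|)) => [|u ->] //.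
rewrite [X in _ + X](eq_bigr (fun _ => #|S|)) => [|u /negbTE->] //.
have cC' : #|[pred u | u \notin S]| = #|T| - #|S| by rewrite -cC; apply: eq_card => u; rewrite !inE.
rewrite !sum_nat_const cC'.
by rewrite -addnn [X in _ + X]mulnC.
Qed.

Lemma next_neq_prev (T : finType) (c : seq T) x :
  uniq c -> 2 < size c -> x \in c -> next c x != prev c x.
Proof.
move=> Uc sc xc; apply/eqP => e.
have j := index_next Uc (etrans (mem_prev c x) xc); rewrite next_prev // in j.
have k := index_next Uc xc; rewrite e in k.
have := xc; rewrite -index_mem => i1; have := xc; rewrite -(mem_prev c x) -index_mem => i2.
by move: j k; rewrite !modS //; do 2! case: eqP => ?; lia.
Qed.

Section GraphPresentation.
Variables (G : sgraph) (c : seq G) (par : G -> G) (h : G -> nat).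
Hypothesis P : presentation (@adj G) c par h.
Let Uc := pres_uniq P.
Let sc := pres_size P.
Local Notation desc := (desc par).
Local Notation rt := (rt par h).
Local Notation s w := #|desc w|.

Lemma pres_connected : connected G.
Proof.
by move=> u v; have [p [up lp _]] := delta_path P u v; apply/connectP; exists p.
Qed.

Lemma dist_delta (u v : G) : dist u v = delta c par h u v.
Proof.
apply/eqP; rewrite eqn_leq; apply/andP; split.
  by have [p [up <- <-]] := delta_path P u v; apply: dist_le.
by have [p [up <- <-]] := dist_path (pres_connected u v); apply: path_delta P _ _ up.
Qed.

Lemma cyc_size : #|[pred x | x \in c]| = size c.
Proof. exact/card_uniqP. Qed.

Lemma cyc_ncyc : size c + #|[pred x | x \notin c]| = #|G|.
Proof. by rewrite -cyc_size -(cardC [pred x | x \in c]); congr (_ + _); apply: eq_card. Qed.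

Lemma sum_dcyc y : y \in c -> \sum_(x | x \in c) dcyc c y x = csum (size c).
Proof.
move=> yc; have iy := yc; rewrite -index_mem in iy.
rewrite -(sum_cdist (Ordinal iy)) -big_uniq //= (big_nth y) big_mkord.
by apply: eq_bigr => i _; rewrite /dcyc index_uniq.
Qed.

(** Sum [delta] over ordered pairs. After exchanging sums, each bridge counts the pairs it
    separates. Cycle distances from one root to all cycle vertices add up to [csum]; mixed pairs
    occur in both orders, hence the doubled number of off-cycle vertices. *)
Lemma wienerE : (wiener G).*2 =
  (\sum_(w | w \notin c) s w * (#|G| - s w)).*2
  + (size c + #|[pred x | x \notin c]|.*2) * csum (size c)
  + \sum_(u | u \notin c) \sum_(v | v \notin c) dcyc c (rt u) (rt v).
Proof.
rewrite -(sum_dist pres_connected).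
under eq_bigr => u _ do under eq_bigr => v _ do rewrite dist_delta /delta.
under eq_bigr => u _ do rewrite big_split /=.
rewrite big_split /= -addnA; congr (_ + _).
  transitivity (\sum_(u : G) \sum_(v : G) \sum_(w | w \notin c)
                  ((u \in desc w) (+) (v \in desc w))).
    apply: eq_bigr => u _; apply: eq_bigr => v _.
    rewrite -sum1_card [RHS]big_mkcond [LHS]big_mkcond /=; apply: eq_bigr => w _.
    by rewrite in_set; case: (w \in c) => //=; case: (_ (+) _).
  under eq_bigr => u _ do rewrite exchange_big /=.
  rewrite exchange_big /= -mul2n big_distrr /=; apply: eq_bigr => w _.
  by rewrite sum_xor mul2n.
rewrite (bigID (fun u => u \in c)) /=.
have E u : \sum_(v : G) dcyc c (rt u) (rt v) =
    csum (size c) + \sum_(v | v \notin c) dcyc c (rt u) (rt v).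
  rewrite (bigID (fun v => v \in c)) /=; congr (_ + _).
  rewrite -(sum_dcyc (rt_mem P u)); apply: eq_bigr => v vc.
  by rewrite (rt_c P vc).
under eq_bigr => u _ do rewrite E.
under [X in _ + X]eq_bigr => u _ do rewrite E.
rewrite !big_split /=.
have -> : \sum_(u in c) \sum_(v | v \notin c) dcyc c (rt u) (rt v) =
    \sum_(v | v \notin c) csum (size c).
  rewrite exchange_big /=; apply: eq_bigr => v _; rewrite -(sum_dcyc (rt_mem P v)).
  by apply: eq_bigr => u uc; rewrite dcyc_sym (rt_c P uc).
by rewrite !sum_nat_const cyc_size; set N := #|_|; lia.
Qed.

Definition children (v : G) : {set G} := [set w | (w \notin c) && (par w == v)].

Lemma degreeE v : degree v = #|children v| + (if v \in c then 2 else 1).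
Proof.
rewrite /degree; case: ifP => [vc|/negbT vc].
  have np := next_neq_prev Uc sc vc.
  have -> : [set w | adj v w] = children v :|: [set next c v; prev c v].
    apply/setP => w; rewrite !inE (pres_adj P) /padj /cadj vc /=.
    rewrite -(can2_eq (prev_next Uc) (next_prev Uc)).
    rewrite orbC [v == par w]eq_sym; congr (_ || _).
    have [->|w1] := eqVneq w (next c v); first by rewrite mem_next vc.
    rewrite eq_sym; have [e|w2] := eqVneq (next c w) v; last by rewrite andbF.
    by rewrite -(mem_next c w) e vc.
  rewrite cardsU cards2 np /= (_ : _ :&: _ = set0) ?cards0 ?subn0 //.
  apply/setP => w; rewrite !inE; apply/negbTE; rewrite negb_and orbC negb_and negbK.
  rewrite -implybE; apply/implyP => /orP[]/eqP->; first by rewrite mem_next vc.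
  by rewrite mem_prev vc.
have -> : [set w | adj v w] = par v |: children v.
  apply/setP => w; rewrite !inE (pres_adj P) /padj /cadj (negPf vc) /=.
  by rewrite [v == _]eq_sym.
rewrite cardsU1 inE; case: eqVneq => [e|_]; last by rewrite andbF addnC.
by have := par_notin_desc P vc; rewrite (descE par (par v) v) e desc_refl orbT.
Qed.

Lemma sum_children (S : {set G}) :
  \sum_(v in S) #|children v| = #|[set x | (x \notin c) && (par x \in S)]|.
Proof.
rewrite -[RHS]sum1_card [RHS](partition_big par (mem S)) /=; last first.
  by move=> x; rewrite in_set => /andP[].
apply: eq_bigr => v vS; rewrite -sum1_card; apply: eq_bigl => x; rewrite !inE.
by have [->|] := eqVneq (par x) v; rewrite ?andbF // vS !andbT.
Qed.

Lemma sum_degree : \sum_(v : G) degree v = #|G|.*2.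
Proof.
under eq_bigr => v _ do rewrite degreeE.
have sumT (F : G -> nat) : \sum_(v : G) F v = \sum_(v in [set: G]) F v.
  by apply: eq_bigl => v; rewrite inE.
rewrite big_split /= [X in X + _]sumT [X in X + _]sum_children.
rewrite (bigID (fun u => u \in c)) /=.
rewrite (eq_bigr (fun _ => 2)) => [|u ->] //.
rewrite [X in _ + (_ + X)](eq_bigr (fun _ => 1)) => [|u /negbTE->] //.
rewrite !sum_nat_const cyc_size -cyc_ncyc.
rewrite (eq_card (_ : _ =i [pred x | x \notin c])); last by move=> x; rewrite !inE andbT.
by set N := #|[pred x | x \notin c]|; rewrite -/N; lia.
Qed.

(** The descendants of [w] span a tree, with one edge fewer than vertices, and the bridge above [w]
    contributes one more edge end. In particular the degree sum is odd. *)
Lemma sum_degree_desc w : w \notin c -> (\sum_(v in desc w) degree v).+1 = (s w).*2.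
Proof.
move=> wc; under eq_bigr => v _ do rewrite degreeE.
rewrite big_split /= sum_children.
rewrite [X in _ + X](eq_bigr (fun _ => 1)) => [|v vw]; last first.
  by rewrite (negPf (desc_ncyc P wc vw)).
rewrite sum1_card (_ : [set x | _] = desc w :\ w); first by rewrite [s w](cardsD1 w) desc_refl; lia.
apply/setP => x; rewrite [LHS]in_set in_setD1 (descE par x w).
have [->|_] := eqVneq x w; first by rewrite wc (negPf (par_notin_desc P wc)).
by apply: andb_idl => /(desc_ncyc P wc); apply: contra => xc; rewrite (pres_par P).
Qed.

Definition oddv : {set G} := [set v | odd (degree v)].

Lemma odd_sum (S : {set G}) : odd (\sum_(v in S) degree v) = odd #|S :&: oddv|.
Proof.
rewrite -sum1_card big_mkcond [in RHS]big_mkcond /=.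
elim/big_rec2: _ => // v m k _ IH; rewrite !oddD -IH inE [v \in oddv]inE.
by case: (v \in S) => //=; case: (odd (degree v)).
Qed.

Lemma odd_oddv : ~~ odd #|oddv|.
Proof.
rewrite -[oddv]setTI -odd_sum (eq_bigl xpredT) ?sum_degree ?odd_double // => v.
by rewrite inE.
Qed.

Lemma desc_has_odd w : w \notin c -> exists2 x, x \in oddv & x \in desc w.
Proof.
move=> wc; have := sum_degree_desc wc; have := odd_sum (desc w).
have [->|[x]] := set_0Vmem (desc w :&: oddv).
  by rewrite cards0 => e e2; have := odd_double (s w); rewrite -e2 /= e.
by rewrite in_setI => /andP[xw xo] _ _; exists x.
Qed.

(** The total degree sum is even and the one over [desc w] is odd, so the one over the complement is
    odd too. *)
Lemma codesc_has_odd w : w \notin c -> exists2 x, x \in oddv & x \notin desc w.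
Proof.
move=> wc; have := sum_degree_desc wc; have := odd_sum (~: desc w).
have := sum_degree; rewrite (bigID (mem (desc w))) /=.
rewrite [X in _ + X](eq_bigl (mem (~: desc w))) => [|x]; last by rewrite /= in_setC.
have [->|[x]] := set_0Vmem (~: desc w :&: oddv).
  rewrite cards0 => e e2 e3; have := odd_double (s w); rewrite -e3 /=.
  by have := odd_double #|G|; rewrite -e oddD e2 addbF => ->.
by rewrite in_setI in_setC => /andP[xw xo] _ _ _; exists x.
Qed.

Lemma pres_is_cycle : is_cycle c.
Proof.
split=> //; rewrite /ucycle Uc andbT; apply: cycle_from_next => // x.
exact: next_adj P _.
Qed.

(* A vertex of maximal rank among those of [c1] off [c] would have its parent as
   its only neighbour on [c1]. *)
Lemma is_cycle_sub c1 : is_cycle c1 -> {subset c1 <= c}.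
Proof.
move=> [/andP[cyc1 U1] s1] x0 x0c1; apply: contraT => x0c.
pose Q x := (x \in c1) && (x \notin c).
case: (arg_maxnP h (_ : Q x0)) => [|x /andP[xc1 xc] max]; first by rewrite /Q x0c1.
have neq := next_neq_prev U1 s1 xc1.
have key y : y \in c1 -> adj x y -> y = par x.
  move=> yc1; rewrite (pres_adj P) /padj /cadj (negPf xc) /= => /orP[/eqP//|/andP[yc /eqP e]].
  have hy : h y <= h x by apply: max; rewrite /Q yc1.
  by have := pres_rank P yc; rewrite -e ltnNge hy.
case/eqP: neq; rewrite (key (next c1 x)) ?mem_next ?next_cycle //.
rewrite (key (prev c1 x)) ?mem_prev // adj_sym.
exact: prev_cycle.
Qed.

Lemma cadj_next x y : cadj c x y -> y = next c x \/ y = prev c x.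
Proof. by case/and3P => _ _ /orP[]/eqP->; [left|right; rewrite prev_next]. Qed.

(** By [is_cycle_sub] any cycle [c1] stays within [c]. The two [c1]-neighbours of a vertex are then
    its two [c]-neighbours, so [c1] is closed under [next c], covers [c] and has the same edges. *)
Lemma pres_unicyclic : unicyclic G.
Proof.
have uniqc c1 : is_cycle c1 -> cycle_edges c1 = cycle_edges c.
  move=> cyc1; have sub1 := is_cycle_sub cyc1; case: cyc1 => /andP[cyc1 U1] s1.
  have adjc x y : x \in c1 -> y \in c1 -> adj x y -> y = next c x \/ y = prev c x.
    move=> xc1 yc1; rewrite (pres_adj P) /padj !sub1 //= orbF; exact: cadj_next.
  have neq x := @next_neq_prev _ c1 x U1 s1.
  have nx x : x \in c1 -> next c1 x = next c x \/ next c1 x = prev c x.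
    by move=> xc1; apply: adjc; rewrite ?mem_next ?next_cycle.
  have px x : x \in c1 -> prev c1 x = next c x \/ prev c1 x = prev c x.
    by move=> xc1; apply: adjc; rewrite ?mem_prev // adj_sym prev_cycle.
  have np x : x \in c1 -> next c x = next c1 x \/ next c x = prev c1 x.
    move=> xc1; have := neq x xc1.
    by case: (nx x xc1) => ->; [left|case: (px x xc1) => ->; [right|rewrite eqxx]].
  have [x0 x0c1] : exists x0, x0 \in c1 by case: (c1) s1 => // x l _; exists x; rewrite mem_head.
  have sub2 : {subset c <= c1}.
    move=> y yc; have := fconnect_cycle (cycle_next Uc) (sub1 _ x0c1) y; rewrite yc.
    move/iter_findex => <-; elim: findex => //= k IHk.
    by case: (np _ IHk) => ->; rewrite ?mem_next ?mem_prev.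
  apply/setP => e; apply/imsetP/imsetP => [] [x xc ->].
    case: (nx x xc) => ->; first by exists x; rewrite ?sub1.
    exists (prev c x); first by rewrite mem_prev sub1.
    by rewrite next_prev // setUC.
  case: (np x (sub2 x xc)) => ->; first by exists x; rewrite ?sub2.
  exists (prev c1 x); first by rewrite mem_prev sub2.
  by rewrite next_prev // setUC.
split; first exact: pres_connected.
  by exists c; apply: pres_is_cycle.
by move=> c1 c2 /uniqc-> /uniqc->.
Qed.

Lemma rot_presentation k : presentation (@adj G) (rot k c) par h.
Proof.
split; rewrite ?rot_uniq ?size_rot //.
- by move=> x; rewrite mem_rot; apply: pres_par P _.
- by move=> x; rewrite mem_rot; apply: pres_rank P _.
by move=> u v; rewrite (pres_adj P) /padj /cadj !mem_rot !next_rot.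
Qed.

End GraphPresentation.

(** A simple [e]-path from [u] to [v] is closed by the edge between them; as this edge is not in
    [e], the path has at least two edges. *)
Lemma extra_edge_cycle (G : sgraph) (e : rel G) (u v : G) :
  subrel e adj -> connect e u v -> adj u v -> ~~ e u v ->
  exists2 c, is_cycle c & [set u; v] \in cycle_edges c.
Proof.
move=> sube /connectP[p0 up0 ->]; case/shortenP: up0 => p up Up _ auv euv.
exists (u :: p).
  split; last first.
    case: p up Up auv euv => [|x [|y p]] //=; first by rewrite adj_irr.
    by rewrite andbT => -> _ _.
  rewrite /ucycle Up andbT /= rcons_path (sub_path sube up) /=.
  by rewrite adj_sym.
apply/imsetP; exists (last u p); first exact: mem_last.
rewrite setUC; congr [set _; _].
rewrite next_nth mem_last; case/lastP: p {up auv euv} Up => [|p x] /= Up; first by rewrite eqxx.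
rewrite last_rcons; have -> : (u == x) = false.
  by move: Up => /andP[]; rewrite mem_rcons inE negb_or => /andP[/negPf].
move: Up => /andP[_]; rewrite rcons_uniq => /andP[xp _].
by rewrite -cats1 index_cat (negPf xp) /= eqxx addn0 nth_default // size_cat /= addn1.
Qed.

(* The parent is a neighbour closer to a fixed vertex of the cycle; any further
   edge would close a second cycle. *)
Lemma unicyclic_presentation (G : sgraph) : unicyclic G ->
  exists c par h, presentation (@adj G) c par h.
Proof.
move=> [cG [c [/andP[cyc Uc] sc]] uniqc].
have [x0 x0c] : exists x0, x0 \in c by case: (c) sc => // x l _; exists x; rewrite mem_head.
pose h v := dist v x0.
have exP v : v \notin c -> exists w, adj v w && (h w < h v).
  move=> vc; have [[|w p] [vp lp sp]] := dist_path (cG v x0).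
    by case/negP: vc; rewrite -lp in x0c.
  exists w; case/andP: vp => -> wp /=; rewrite /h -sp /= ltnS.
  by move: lp => /= <-; apply: dist_le.
pose par v := if v \in c then v else odflt v [pick w | adj v w && (h w < h v)].
have parP v : v \notin c -> adj v (par v) /\ h (par v) < h v.
  move=> vc; rewrite /par (negPf vc); case: pickP => [w /andP//|no].
  by have [w] := exP v vc; rewrite no.
exists c, par, h; split=> //.
- by move=> x xc; rewrite /par xc.
- by move=> x /parP[].
have sube : subrel (padj c par) adj.
  move=> u v /or3P[/and3P[uc vc /orP[]/eqP->]|/andP[uc /eqP->]|/andP[vc /eqP->]].
  - exact: next_cycle.
  - by rewrite adj_sym; apply: next_cycle.
  - by have [] := parP u uc.
  by rewrite adj_sym; have [] := parP v vc.
have symc : connect_sym (padj c par) by apply: sym_connect_sym; apply: padj_sym.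
have conc u : connect (padj c par) x0 u.
  have [m] := ubnP (h u); elim: m u => // m IHm u lt_um.
  have [uc|uc] := boolP (u \in c).
    have := fconnect_cycle (cycle_next Uc) x0c u; rewrite uc.
    apply: connect_sub => x y /eqP <-; have [xc|xc] := boolP (x \in c).
      by apply: connect1; rewrite /padj /cadj xc mem_next xc eqxx.
    by rewrite next_nth (negPf xc) connect0.
  apply: connect_trans (IHm (par u) _) _.
    by have [] := parP u uc; lia.
  by apply: connect1; rewrite /padj uc eqxx /= !orbT.
move=> u v; apply/idP/idP => [auv|/sube//]; apply: contraT => nuv.
have [|c1 cyc1] := extra_edge_cycle sube _ auv nuv.
  by rewrite (connect_trans _ (conc v)) // symc.
rewrite (uniqc c1 c) //; last by split=> //; rewrite /ucycle cyc.
case/imsetP => x xc euv; case/negP: nuv; apply/orP; left.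
have /setP euv' := euv; have := euv' u; have := euv' v; rewrite !inE !eqxx /= orbT => Ev Eu.
have uv : u != v by apply: contraTneq auv => ->; rewrite adj_irr.
move: Ev Eu uv => /esym/orP[]/eqP-> /esym/orP[]/eqP->; rewrite ?eqxx // => _.
  by rewrite /cadj !mem_next xc eqxx orbT.
by rewrite /cadj !mem_next xc eqxx.
Qed.

(** * Small sides of the bridges *)

Lemma half_gap n k : k < n./2 -> 0 < n - 1 - k.*2.
Proof. lia. Qed.

(** The step from [k] to [k + 1] raises [k (n - k)] by [n - 1 - 2 k]. The range [n./2] does not
    depend on [m], so that sums over several bridges can be exchanged with this one. *)
Lemma layer_cake n m : m <= n./2 ->
  m * (n - m) = \sum_(k < n./2) (k < m) * (n - 1 - k.*2).
Proof.
move=> le_m; rewrite -(big_mkord xpredT (fun k => (k < m) * (n - 1 - k.*2))).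
rewrite (big_cat_nat (leq0n m) le_m) /= [X in _ + X]big1_seq ?addn0; last first.
  by move=> k /andP[_]; rewrite mem_index_iota => /andP[le_mk _]; rewrite ltnNge le_mk.
have -> : \sum_(0 <= k < m) (k < m) * (n - 1 - k.*2) = \sum_(0 <= k < m) (n - 1 - k.*2).
  by apply: eq_big_nat => k /andP[_ ->]; rewrite mul1n.
elim: m le_m => [|m IHm] le_m; first by rewrite big_geq.
rewrite big_nat_recr //= -IHm; last lia.
have [d ->] : exists d, n = m + m + d + 2 by exists (n - (m + m + 2)); lia.
have -> : m + m + d + 2 - m.+1 = m + d + 1 by lia.
have -> : m + m + d + 2 - m = m + d + 2 by lia.
have -> : m + m + d + 2 - 1 - m.*2 = d + 1 by lia.
by lia.
Qed.

Lemma card_le (T : finType) (A : {set T}) : #|A| <= #|T|.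
Proof. by rewrite -cardsT subset_leq_card ?subsetT. Qed.

Section Sides.
Variables (G : sgraph) (c : seq G) (par : G -> G) (h : G -> nat).
Hypothesis P : presentation (@adj G) c par h.
Let Uc := pres_uniq P.
Let sc := pres_size P.
Local Notation desc := (desc par).
Local Notation s w := #|desc w|.
Local Notation N := #|[pred x | x \notin c]|.
Local Notation p := #|oddv G|.

Variable n : nat.
Hypothesis nE : #|G| = n.

(* The smaller side of the bridge above [w]. *)
Definition side w : {set G} := if (s w).*2 <= n then desc w else ~: desc w.

Lemma desc_gt0 w : 0 < s w.
Proof. by apply/card_gt0P; exists w; apply: desc_refl. Qed.

Lemma card_desc_cyc w : w \notin c -> s w + size c <= n.
Proof.
move=> wc; rewrite -nE -(cyc_ncyc P) addnC leq_add2l; apply: subset_leq_card.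
by apply/subsetP => x /(desc_ncyc P wc).
Qed.

Lemma card_side w : #|side w| = minn (s w) (n - s w).
Proof.
by have := cardsC (desc w); rewrite nE /side; case: leqP => ?; lia.
Qed.

Lemma card_side_gt0 w : w \notin c -> 0 < #|side w|.
Proof.
by move=> wc; rewrite card_side; have := desc_gt0 w; have := card_desc_cyc wc; lia.
Qed.

Lemma card_side_half w : #|side w| <= n./2.
Proof. by rewrite card_side; lia. Qed.

Lemma card_side_cut w : #|side w| * (n - #|side w|) = s w * (n - s w).
Proof.
have := card_le (desc w); rewrite nE card_side => ?.
by case: (leqP (s w) (n - s w)) => // ?; rewrite subKn // mulnC.
Qed.

Lemma side_odd w : w \notin c -> exists2 x, x \in oddv G & x \in side w.
Proof.
move=> wc; rewrite /side; case: ifP => _; first exact: desc_has_odd P _ wc.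
by have [x xo xw] := codesc_has_odd P wc; exists x; rewrite // in_setC.
Qed.

Lemma desc_inj w w' : w \notin c -> desc w = desc w' -> w = w'.
Proof.
by move=> wc e; apply: (desc_anti P wc); rewrite -?e ?desc_refl // e desc_refl.
Qed.

Lemma desc_meet w w' x : x \in desc w -> x \in desc w' ->
  desc w \subset desc w' \/ desc w' \subset desc w.
Proof.
by move=> xw xw'; case: (desc_total xw xw') => /desc_subset; [left|right].
Qed.

(** Two sets with more than half of the vertices each must meet. *)
Lemma big_meet w w' : n < (s w).*2 -> n < (s w').*2 ->
  desc w \subset desc w' \/ desc w' \subset desc w.
Proof.
move=> bw bw'; have [e|[x]] := set_0Vmem (desc w :&: desc w').
  have := cardsUI (desc w) (desc w'); rewrite e cards0.
  by have := card_le (desc w :|: desc w'); rewrite nE; lia.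
by rewrite in_setI => /andP[]; apply: desc_meet.
Qed.

Lemma desc_disj_card w w' : w \notin c -> w' \notin c ->
  desc w :&: desc w' = set0 -> s w + s w' + size c <= n.
Proof.
move=> wc wc' e; have := cardsUI (desc w) (desc w'); rewrite e cards0 addn0 => <-.
rewrite -nE -(cyc_ncyc P) addnC leq_add2l; apply: subset_leq_card.
by apply/subsetP => x; rewrite in_setU => /orP[] /(desc_ncyc P); apply.
Qed.

(** If both sides are descendant sets, or both are complements, the descendant sets are nested and
    of equal size. In the mixed case the descendant sets are either disjoint, leaving no room for
    the cycle, or nested, against [x] or the sizes. *)
Lemma side_disj w w' x : w \notin c -> w' \notin c ->
  #|side w| = #|side w'| -> x \in side w -> x \in side w' -> w = w'.
Proof.
wlog le_w : w w' / s w <= s w'.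
  move=> IH wc wc' e xw xw'; have [le|/ltnW le] := leqP (s w) (s w'); first exact: IH.
  by apply/esym/IH.
move=> wc wc'; rewrite !card_side /side.
have mw := card_desc_cyc wc; have mw' := card_desc_cyc wc'.
case: leqP => bw; case: leqP => bw'; rewrite ?in_setC => e xw xw'.
- apply: desc_inj => //; have es : s w = s w' by lia.
  case: (desc_meet xw xw') => sub; first by apply/eqP; rewrite eqEcard sub es /=.
  by apply/esym/eqP; rewrite eqEcard sub es /=.
- have [e0|[y]] := set_0Vmem (desc w :&: desc w').
    by have := desc_disj_card wc wc' e0; lia.
  rewrite in_setI => /andP[yw yw'].
  case: (desc_meet yw yw') => sub; first by rewrite (subsetP sub _ xw) in xw'.
  by have := subset_leq_card sub; lia.
- lia.
apply: desc_inj => //; have es : s w = s w' by lia.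
case: (big_meet bw bw') => sub; first by apply/eqP; rewrite eqEcard sub es /=.
by apply/esym/eqP; rewrite eqEcard sub es /=.
Qed.

Definition level k : {set G} := [set w | (w \notin c) && (#|side w| == k)].
Definition above k : nat := #|[set w | (w \notin c) && (k <= #|side w|)]|.

(** Injective on each level, this bounds the level by the number of odd vertices. For [w] off the
    cycle the default is never reached. *)
Definition side_rep w : G := odflt w [pick x in side w | x \in oddv G].

Lemma side_repP w : w \notin c -> side_rep w \in oddv G /\ side_rep w \in side w.
Proof.
move=> wc; rewrite /side_rep; case: pickP => [x /andP[]//|no].
by have [x xo xw] := side_odd wc; have := no x; rewrite /= xw xo.
Qed.

Lemma side_rep_inj k : {in level k &, injective side_rep}.
Proof.
move=> w w'; rewrite !in_set => /andP[wc /eqP kw] /andP[wc' /eqP kw'] e.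
have [_ xw] := side_repP wc; have [_ xw'] := side_repP wc'.
by apply: (side_disj wc wc' _ xw); rewrite ?kw ?kw' // e.
Qed.

Lemma side_rep_sub k : side_rep @: level k \subset oddv G.
Proof.
apply/subsetP => _ /imsetP[w wk ->]; move: wk; rewrite in_set => /andP[wc _].
by have [] := side_repP wc.
Qed.

Lemma level_le k : #|level k| <= p.
Proof. by rewrite -(card_in_imset (@side_rep_inj k)) subset_leq_card ?side_rep_sub. Qed.

(** On a level of maximal size the injection [side_rep] is onto the odd vertices. *)
Lemma level_cover k x : #|level k| = p -> x \in oddv G ->
  exists w, [/\ w \notin c, #|side w| = k & x \in side w].
Proof.
move=> e; have /eqP <- : side_rep @: level k == oddv G.
  by rewrite eqEcard side_rep_sub (card_in_imset (@side_rep_inj k)) e /=.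
case/imsetP => w wk ->; move: wk; rewrite in_set => /andP[wc /eqP kw].
by exists w; have [] := side_repP wc.
Qed.

Lemma above1 : above 1 = N.
Proof.
apply: eq_card => w; rewrite in_set inE; apply: andb_idr; exact: card_side_gt0.
Qed.

Lemma aboveS k : above k = #|level k| + above k.+1.
Proof.
rewrite /above; set A := [set w | _ & k <= _]; set B := [set w | _ & k < _].
rewrite -cardsUI (_ : _ :&: B = set0) ?cards0 ?addn0.
  congr #|pred_of_set _|; apply/setP => w; rewrite !in_set (leq_eqVlt k).
  by case: (w \in c); rewrite ?andbF //= eq_sym.
by apply/setP => w; rewrite !in_set; case: (w \in c) => //=; case: ltngtP.
Qed.

(** Each of the levels 1, ..., [k] contains at most [p] of the [N] bridges. *)
Lemma above_ge k : N <= above k.+1 + p * k.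
Proof.
elim: k => [|k IHk]; first by rewrite above1 muln0 addn0.
by have := aboveS k.+1; have := level_le k.+1; rewrite mulnS; lia.
Qed.

(* The cut sum [sum_w s_w (m - s_w)] of [q] balanced branches with [M] vertices in
   all: exactly [M - q * k] of them have more than [k] descendants. *)
Definition star_cut m M q := \sum_(k < m./2) (M - q * k) * (m - 1 - k.*2).

Lemma sum_cutE : \sum_(w | w \notin c) s w * (n - s w) =
  \sum_(k < n./2) above k.+1 * (n - 1 - k.*2).
Proof.
transitivity (\sum_(w | w \notin c) \sum_(k < n./2) (k < #|side w|) * (n - 1 - k.*2)).
  by apply: eq_bigr => w _; rewrite -card_side_cut layer_cake ?card_side_half.
rewrite exchange_big /=; apply: eq_bigr => k _; rewrite -big_distrl /=; congr (_ * _).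
rewrite /above -[RHS]sum1_card [LHS]big_mkcond [RHS]big_mkcond; apply: eq_bigr => w _ /=.
by rewrite in_set; case: (w \in c) => //=; case: ltnP.
Qed.

Lemma sum_cut_ge : star_cut n N p <= \sum_(w | w \notin c) s w * (n - s w).
Proof.
rewrite sum_cutE; apply: leq_sum => k _; rewrite leq_mul2r leq_subLR addnC above_ge.
exact: orbT.
Qed.

(** The weights [n - 1 - k.*2] are positive, so equality of the sums forces equality in every
    term. *)
Lemma sum_cut_eq : \sum_(w | w \notin c) s w * (n - s w) <= star_cut n N p ->
  forall k, k < n./2 -> above k.+1 = N - p * k.
Proof.
move=> le k lt_k; apply/eqP; rewrite eqn_leq andbC leq_subLR addnC above_ge /=.
rewrite leqNgt; apply/negP => gt; move: le; rewrite leqNgt => /negP; apply.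
rewrite sum_cutE /star_cut (bigD1 (Ordinal lt_k)) //= [ltnRHS](bigD1 (Ordinal lt_k)) //=.
rewrite -addSn leq_add //; last first.
  by apply: leq_sum => i _; rewrite leq_mul2r leq_subLR addnC above_ge orbT.
by rewrite ltn_mul2r gt andbT; apply: half_gap.
Qed.

(** * The equality case: balanced branches *)

Section Balanced.
Hypothesis bal : forall k, k < n./2 -> above k.+1 = N - p * k.

Lemma level_full k w : w \notin c -> k.+2 <= #|side w| -> #|level k.+1| = p.
Proof.
move=> wc le_k; have lt_k : k.+1 < n./2 by apply: leq_trans le_k (card_side_half w).
have := aboveS k.+1; rewrite !bal //; last exact: ltnW.
have : 0 < above k.+2 by apply/card_gt0P; exists w; rewrite in_set wc.
by rewrite bal // mulnS; lia.
Qed.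

(** Level [k + 1] is full, so one of its sides contains the odd vertex found in [side w]. *)
Lemma side_pred k w : w \notin c -> #|side w| = k.+2 ->
  exists w', [/\ w' \notin c, #|side w'| = k.+1 & exists2 x, x \in side w & x \in side w'].
Proof.
move=> wc ek; have [x xo xw] := side_odd wc.
have [|w' [wc' ew' xw']] := @level_cover k.+1 x _ xo.
  by apply: level_full wc _; rewrite ek.
by exists w'; split=> //; exists x.
Qed.

(** Take a violating [w] with the most descendants. Its smaller side contains the cycle, so
    [side_pred] gives [w'] with a side smaller by one that meets it. If [w'] is violating too, it
    contradicts maximality; otherwise [desc w'] is disjoint from [desc w], which leaves one vertex
    for the cycle, or nested with it, which is impossible as well. *)
Lemma desc_not_big w : w \notin c -> (s w).*2 <= n.
Proof.
move=> wc; rewrite leqNgt; apply/negP => bw.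
pose Q w := (w \notin c) && (n < (s w).*2).
have Qw : Q w by rewrite /Q wc.
case: (arg_maxnP (fun w => s w) Qw) => {wc bw Qw}w /andP[wc bw] max.
have := card_side w; have := card_desc_cyc wc => mw kw.
have [k ek] : exists k, #|side w| = k.+2 by exists (#|side w|.-2); lia.
have [w' [wc' ew' [x xw xw']]] := side_pred wc ek.
have mw' := card_desc_cyc wc'; have := card_side w' => kw'.
move: xw xw'; rewrite /side leqNgt bw /= in_setC => xw.
case: leqP => [bw'|bw' _]; last first.
  by have := max w'; rewrite /Q wc' bw' /= => /(_ isT); lia.
move=> xw'; have [e0|[y]] := set_0Vmem (desc w :&: desc w').
  by have := desc_disj_card wc wc' e0; lia.
rewrite in_setI => /andP[yw yw']; case: (desc_meet yw yw') => sub.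
  by have := subset_leq_card sub; lia.
by rewrite (subsetP sub _ xw') in xw.
Qed.

Lemma side_desc w : w \notin c -> side w = desc w.
Proof. by move=> wc; rewrite /side desc_not_big. Qed.

(** The vertex [w'] from [side_pred] lies strictly below [w] and has one descendant fewer, so its
    descendants are those of [w] other than [w]. The child [v] is among them and must be [w']. *)
Lemma only_child w v : w \notin c -> v \notin c -> par v = w -> s w = (s v).+1.
Proof.
move=> wc vc pv; have vw : v \in desc w by rewrite (descE par v w) pv desc_refl orbT.
have wv : w \notin desc v by rewrite -pv (par_notin_desc P).
have sub : w |: desc v \subset desc w.
  by rewrite subUset sub1set desc_refl desc_subset.
have := subset_leq_card sub; rewrite cardsU1 wv add1n => lt_s.
have [k ek] : exists k, #|side w| = k.+2.
  by exists (s w).-2; rewrite side_desc //; have := desc_gt0 v; lia.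
have [w' [wc' ew' [x xw xw']]] := side_pred wc ek.
rewrite !side_desc // in ek ew' xw xw'.
case: (desc_total xw xw') => ww'.
  by have := subset_leq_card (desc_subset ww'); rewrite ek ew' ltnn.
have neq : w' != w.
  by apply/eqP => e; move: ek; rewrite -e ew' => /eqP; rewrite eqn_leq ltnn andbF.
move: ww'; rewrite (descE par w' w) (negPf neq) /= => pw'.
have nsub : desc w :\ w = desc w'.
  apply/esym/eqP; rewrite eqEcard; apply/andP; split; last first.
    by move: ek; rewrite (cardsD1 w) desc_refl ew' add1n => -[->].
  rewrite subsetD1 (desc_subset (descW pw')) /=.
  apply/negP => ww'; have := desc_anti P wc' (descW pw') ww'.
  by move=> e; rewrite e eqxx in neq.
have vw' : v \in desc w'.
  rewrite -nsub in_setD1 vw andbT; apply: contraTneq isT => e.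
  by move: wv; rewrite -e desc_refl.
have [e|vnw'] := eqVneq v w'; first by rewrite e ek ew'.
move: vw'; rewrite (descE par v w') (negPf vnw') pv /= => ww'.
by have := subset_leq_card (desc_subset ww'); rewrite ek ew' ltnn.
Qed.

Lemma has_child w : w \notin c -> 1 < s w -> exists2 v, v \notin c & par v = w.
Proof.
move=> wc gt1; have [x] : exists x, x \in desc w :\ w.
  by apply/card_gt0P; move: gt1; rewrite (cardsD1 w) desc_refl.
rewrite in_setD1 => /andP[xw /descP[k]].
elim: k x xw => [|k IHk] x xw; first by move=> /= e; rewrite e eqxx in xw.
rewrite iterSr => e; have [pxw|/IHk] := eqVneq (par x) w; last exact.
by exists x => //; apply: contra xw => xc; rewrite -pxw (pres_par P).
Qed.

(** Level 1 is full, so every odd vertex lies in a side of size 1, which is a descendant set and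
    avoids the cycle. *)
Lemma oddv_ncyc x : p <= N -> x \in oddv G -> x \notin c.
Proof.
move=> pN xo; have gtp : 0 < p by apply/card_gt0P; exists x.
have full : #|level 1| = p.
  have := aboveS 1; rewrite above1; have [lt2|ge2] := ltnP 1 n./2.
    by rewrite bal // muln1; have := level_le 1; lia.
  have := cyc_ncyc P; rewrite nE; lia.
have [w [wc ew xw]] := level_cover full xo.
by move: xw; rewrite side_desc //; apply: (desc_ncyc P).
Qed.

(** Otherwise level [s v + 1] is full and covers an odd vertex below [v] by some [desc w']. Then
    [w'] would be a proper ancestor of [v] off the cycle, but [par v] is on it. *)
Lemma top_ge w v : w \notin c -> v \notin c -> par v \in c -> s w <= (s v).+1.
Proof.
move=> wc vc pvc; rewrite leqNgt; apply/negP => lt_s.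
have [x xo xv] := side_odd vc; rewrite side_desc // in xv.
have [|w' [wc' ew' xw']] := @level_cover (s v).+1 x _ xo.
  by apply: (@level_full _ w wc); rewrite side_desc.
rewrite side_desc // in ew' xw'.
case: (desc_total xw' xv) => sub; first by have := subset_leq_card (desc_subset sub); lia.
move: sub; rewrite (descE par v w') => /orP[/eqP e|pv]; first by rewrite e in ew'; lia.
by have := desc_ncyc P wc' pv; rewrite pvc.
Qed.

End Balanced.
End Sides.

(** * Recognising H(T_1, ..., T_l) *)

Section Gluing.
Variables (G : sgraph) (c : seq G) (par : G -> G) (h : G -> nat).
Hypothesis P : presentation (@adj G) c par h.
Let Uc := pres_uniq P.
Let sc := pres_size P.
Local Notation desc := (desc par).
Local Notation rt := (rt par h).
Local Notation s w := #|desc w|.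

(* [T] is isomorphic, as a rooted tree, to the tree hanging at [v0]. *)
Definition tree_at (T : rooted_graph) (v0 : G) : Prop :=
  exists phi : T -> G,
    [/\ injective phi,
        forall v, rt v = v0 -> exists x, phi x = v,
        forall x, rt (phi x) = v0,
        phi (rg_root T) = v0
      & forall x y, adj (phi x) (phi y) = adj x y].

Lemma cadj_nth x0 i j : i < size c -> j < size c ->
  cadj c (nth x0 c i) (nth x0 c j) = (i.+1 %% size c == j) || (j.+1 %% size c == i).
Proof.
move=> ic jc; have l0 : 0 < size c by apply: leq_trans sc.
have nx k : k < size c -> next c (nth x0 c k) = nth x0 c (k.+1 %% size c).
  move=> kc; have e := index_next Uc (mem_nth x0 kc).
  by rewrite index_uniq // in e; rewrite -e nth_index // mem_next mem_nth.
rewrite /cadj !mem_nth // !nx // !nth_uniq ?ltn_mod //.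
by rewrite (eq_sym j) (eq_sym i).
Qed.

Lemma adj_rt u v : rt u != rt v -> adj u v = cadj c u v.
Proof.
move=> ne; rewrite (pres_adj P) /padj.
have -> : (u \notin c) && (v == par u) = false.
  by apply: contraNF ne => /andP[_ /eqP->]; rewrite (rt_par P).
have -> : (v \notin c) && (u == par v) = false.
  by apply: contraNF ne => /andP[_ /eqP->]; rewrite (rt_par P).
by rewrite !orbF.
Qed.

(** The embeddings of the trees combine to a bijection [F] onto [G], whose inverse is the
    isomorphism. An edge between vertices with different roots is a cycle edge and joins two
    roots. *)
Lemma H_of_isomorphic (x0 : G) (Ts : seq rooted_graph) : size Ts = size c ->
  (forall i : 'I_(size Ts), tree_at (nth K1 Ts i) (nth x0 c i)) ->
  isomorphic G (H_of Ts).
Proof.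
move=> sz /fin_all_exists[phi phiP].
have lt_i (i : 'I_(size Ts)) : i < size c by rewrite -sz.
pose mk (i : 'I_(size Ts)) (x : nth K1 Ts i) : H_of Ts := existT _ i x.
pose F (z : H_of Ts) : G := phi (tag z) (tagged z).
have Frt z : rt (F z) = nth x0 c (tag z) by have [_ _ /(_ (tagged z)) ? _ _] := phiP (tag z).
have Finj : injective F.
  move=> [i x] [j y] e; have := Frt (mk i x); rewrite e Frt /= => /eqP.
  rewrite nth_uniq // => /eqP/val_inj eij; case: _ / eij x e => x.
  by have [inj _ _ _ _] := phiP j => /inj /= ->.
have Fsurj v : exists z, F z = v.
  have iv : index (rt v) c < size Ts by rewrite sz index_mem (rt_mem P).
  have [_ surj _ _ _] := phiP (Ordinal iv).
  have [|x <-] := surj v; first by rewrite /= nth_index // (rt_mem P).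
  by exists (mk (Ordinal iv) x).
have [g Fg] := fin_all_exists Fsurj.
exists g; first by exists F => // z; apply: Finj; rewrite Fg.
suff Fadj z z' : adj (F z) (F z') = H_adj z z'.
  by move=> u v; rewrite -{2}(Fg u) -{2}(Fg v) Fadj.
case: z z' => i x [j y]; rewrite /H_adj /cyc_adj /=.
have [eij|nij] := eqVneq i j.
  case: _ / eij y => y; rewrite tagged_asE !andbF orbF.
  by have [_ _ _ _ ->] := phiP i.
rewrite /= adj_rt; last by rewrite !Frt /= nth_uniq.
have root (k : 'I_(size Ts)) (t : nth K1 Ts k) : (F (mk k t) \in c) = (t == rg_root _).
  have [inj _ _ r _] := phiP k; apply/idP/eqP => [tc|->].
    by apply: inj; rewrite r -[RHS](Frt (mk k t)) (rt_c P tc).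
  by rewrite /F /= r mem_nth.
have [xr|xr] := boolP (x == rg_root _); last by rewrite /cadj (root i x) (negPf xr).
have [yr|yr] := boolP (y == rg_root _); last by rewrite /cadj (root j y) (negPf yr) !andbF.
rewrite /F /= (eqP xr) (eqP yr).
have [_ _ _ -> _] := phiP i; have [_ _ _ -> _] := phiP j.
by rewrite cadj_nth // -!val_eqE /= -sz.
Qed.

Lemma adj_root_nc v0 u : v0 \in c -> u \notin c -> adj v0 u = (par u == v0).
Proof.
by move=> v0c uc; rewrite (pres_adj P) /padj /cadj v0c uc (negPf uc) /= eq_sym.
Qed.

Lemma adj_nc u v : u \notin c -> v \notin c -> adj u v = (par u == v) || (par v == u).
Proof.
move=> uc vc; rewrite (pres_adj P) /padj /cadj uc vc (negPf uc) /=.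
by rewrite eq_sym [u == _]eq_sym.
Qed.

Lemma tree_at_K1 v0 : v0 \in c -> (forall u, u \notin c -> rt u != v0) -> tree_at K1 v0.
Proof.
move=> v0c no; exists (fun _ => v0); split=> //.
- by case=> [[]].
- move=> v rv; exists tt; have [vc|vc] := boolP (v \in c); first by rewrite -rv (rt_c P).
  by have := no v vc; rewrite rv eqxx.
- by move=> _; rewrite (rt_c P).
by move=> x y; rewrite adj_irr.
Qed.

Lemma tree_at_K2 v0 w : v0 \in c -> w \notin c -> par w = v0 ->
  (forall u, u \notin c -> rt u = v0 -> u = w) -> tree_at K2 v0.
Proof.
move=> v0c wc pw uniqw; have nv : v0 != w by apply: contraNneq wc => <-.
exists (fun b => if b then w else v0); split=> //.
- by move=> [] [] // e; rewrite e eqxx in nv.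
- move=> v rv; have [vc|vc] := boolP (v \in c).
    by exists false; rewrite -rv (rt_c P).
  by exists true; rewrite (uniqw v).
- by case; rewrite -?(rt_par P w) ?pw (rt_c P).
have avw : adj v0 w by rewrite adj_root_nc // pw.
by move=> [] []; rewrite ?adj_irr // adj_sym.
Qed.

(** * Trees that branch only at their root *)

Section Star.
Variable v0 : G.
Hypothesis v0c : v0 \in c.
Hypothesis chain : forall w v, w \notin c -> rt w = v0 -> v \notin c -> par v = w ->
  s w = (s v).+1.

Let B := enum (children c par v0).
(** Goes to the child, or stays put at a leaf. Thus [node i j], for [j] below the branch length, is
    at distance [j + 1] from [v0], as in [star_vertex]. *)
Let step w := odflt w [pick v | (v \notin c) && (par v == w)].
Let node i j := iter j step (nth v0 B i).

Definition branch_lengths : seq nat := [seq s w | w <- B].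

(** A second child [v'] would put [w], [v'] and all of [desc v] below [w], one vertex more than
    [chain] allows. *)
Lemma child_uniq w v v' : w \notin c -> rt w = v0 ->
  v \notin c -> par v = w -> v' \notin c -> par v' = w -> v = v'.
Proof.
move=> wc rw vc pv vc' pv'; apply/eqP; apply: contraT => ne.
have e := chain wc rw vc pv.
have wv : w \notin desc v by rewrite -pv (par_notin_desc P).
have vv : v' \notin desc v by rewrite (descE par v' v) pv' eq_sym (negPf ne).
have sub : w |: (v' |: desc v) \subset desc w.
  rewrite !subUset !sub1set desc_refl (descE par v' w) pv' desc_refl orbT /=.
  by apply: desc_subset; rewrite (descE par v w) pv desc_refl orbT.
have := subset_leq_card sub; rewrite !cardsU1 vv in_setU1 (negPf wv) orbF e.
have -> : (w == v') = false.
  by apply: contraFF (ltnn (h v')) => /eqP ew; rewrite -{1}ew -pv' (pres_rank P).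
by rewrite !add1n ltnn.
Qed.

Lemma stepP w : w \notin c -> rt w = v0 -> 1 < s w -> step w \notin c /\ par (step w) = w.
Proof.
move=> wc rw gt1; rewrite /step; case: pickP => [v /andP[vc /eqP pv]|no]; first by split.
have [v vc pv] := has_child P wc gt1.
by have := no v; rewrite vc pv eqxx.
Qed.

Lemma topP i : i < size B -> nth v0 B i \notin c /\ par (nth v0 B i) = v0.
Proof.
move=> iB; have := mem_nth v0 iB; rewrite mem_enum in_set => /andP[-> /eqP->].
by [].
Qed.

Lemma nodeP i j : i < size B -> j < s (nth v0 B i) ->
  [/\ node i j \notin c, rt (node i j) = v0 & s (node i j) + j = s (nth v0 B i)].
Proof.
move=> iB; elim: j => [|j IHj] lt_j.
  have [bc pb] := topP iB; split; rewrite /node //= ?addn0 //.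
  by rewrite -(rt_par P) pb (rt_c P).
have [nc rn sn] := IHj (ltnW lt_j).
have gt1 : 1 < s (node i j) by move: sn lt_j; clear; lia.
have [sc' ps] := stepP nc rn gt1; rewrite /node iterS -/(node i j); split=> //.
  by rewrite -(rt_par P) ps.
by rewrite -sn (chain nc rn sc' ps) addnS.
Qed.

Lemma par_node i j : i < size B -> j.+1 < s (nth v0 B i) -> par (node i j.+1) = node i j.
Proof.
move=> iB lt_j; have [nc rn sn] := nodeP iB (ltnW lt_j).
have gt1 : 1 < s (node i j) by move: sn lt_j; clear; lia.
by have [] := stepP nc rn gt1.
Qed.

(** Taking parents reduces to [j = 0]. The top of a branch has its parent on the cycle, a deeper
    node does not. *)
Lemma node_inj_le i j i' j' : i < size B -> i' < size B ->
  j < s (nth v0 B i) -> j' < s (nth v0 B i') -> j <= j' ->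
  node i j = node i' j' -> i = i' /\ j = j'.
Proof.
move=> iB iB'; elim: j j' => [|j IHj] [|j'] // lt_j lt_j' le_j e.
- split=> //; apply/eqP; rewrite -(nth_uniq v0 iB iB' (enum_uniq _)).
  exact/eqP.
- have [_ pb] := topP iB; have := par_node iB' lt_j'; rewrite -e /node /= pb => ev.
  by have [] := nodeP iB' (ltnW lt_j'); rewrite /node -ev v0c.
have e' : node i j = node i' j' by rewrite -(par_node iB lt_j) -(par_node iB' lt_j') e.
by have [-> ->] := IHj j' (ltnW lt_j) (ltnW lt_j') le_j e'.
Qed.

Lemma node_inj i j i' j' : i < size B -> i' < size B ->
  j < s (nth v0 B i) -> j' < s (nth v0 B i') ->
  node i j = node i' j' -> i = i' /\ j = j'.
Proof.
move=> iB iB' lt_j lt_j' e; have [le|/ltnW le] := leqP j j'; first exact: node_inj_le.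
by have [-> ->] := node_inj_le iB' iB lt_j' lt_j le (esym e).
Qed.

Lemma node_surj v : rt v = v0 -> v <> v0 ->
  exists i j, [/\ i < size B, j < s (nth v0 B i) & node i j = v].
Proof.
elim/(par_ind P): v => v vc; first by rewrite (rt_c P).
move=> IH rv _; rewrite (rt_par P) in IH.
have [pv|pv] := eqVneq (par v) v0.
  have vB : v \in B by rewrite mem_enum in_set vc pv eqxx.
  exists (index v B), 0; rewrite index_mem /node /= nth_index //; split=> //.
  exact: desc_gt0.
have [||i [j [iB lt_j e]]] := IH; [exact: rv|exact/eqP|].
have [nc rn sn] := nodeP iB lt_j.
have es := chain nc rn vc (esym e).
have gt1 : 1 < s (node i j) by rewrite es ltnS desc_gt0.
have [sc' ps] := stepP nc rn gt1.
exists i, j.+1; split=> //; first by move: gt1 sn; clear; lia.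
exact: child_uniq nc rn sc' ps vc (esym e).
Qed.

Lemma par_node_eq i j i' j' : i < size B -> i' < size B ->
  j < s (nth v0 B i) -> j' < s (nth v0 B i') ->
  (par (node i j) == node i' j') = (i == i') && (j'.+1 == j).
Proof.
move=> iB iB' lt_j lt_j'; case: j lt_j => [|j] lt_j.
  rewrite andbF /node /=; have [_ ->] := topP iB.
  by apply: contraTF v0c => /eqP->; have [] := nodeP iB' lt_j'.
rewrite par_node // eqSS; apply/eqP/andP => [e|[/eqP<- /eqP<-]//].
by have [-> ->] := node_inj iB iB' (ltnW lt_j) lt_j' e.
Qed.

Lemma tree_at_star : tree_at (subdivided_star branch_lengths) v0.
Proof.
have szL : size branch_lengths = size B by rewrite size_map.
have nthL i : i < size B -> nth 0 branch_lengths i = s (nth v0 B i).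
  by move=> iB; rewrite (nth_map v0).
have ltB (i : 'I_(size branch_lengths)) : i < size B by rewrite -szL.
have ltS (i : 'I_(size branch_lengths)) (j : 'I_(nth 0 branch_lengths i)) :
  j < s (nth v0 B i) by rewrite -nthL.
pose phi (x : subdivided_star branch_lengths) : G :=
  if x is Some u then node (tag u) (tagged u) else v0.
exists phi; split=> //.
- move=> [[i j]|] [[i' j']|] //= e.
  + have [ei ej] := node_inj (ltB i) (ltB i') (ltS i j) (ltS i' j') e.
    move/val_inj: ei => ei; case: _ / ei j' ej {e} => j' /val_inj ->.
    by [].
  + by have [] := nodeP (ltB i) (ltS i j); rewrite e v0c.
  + by have [] := nodeP (ltB i') (ltS i' j'); rewrite -e v0c.
- move=> v rv; have [->|/eqP ne] := eqVneq v v0; first by exists None.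
  have [i [j [iB lt_j <-]]] := node_surj rv ne.
  have iL : i < size branch_lengths by rewrite szL.
  have jL : j < nth 0 branch_lengths (Ordinal iL) by rewrite /= nthL.
  by exists (Some (existT (fun i : 'I_(size branch_lengths) => 'I_(nth 0 branch_lengths i))
    (Ordinal iL) (Ordinal jL))).
- by move=> [[i j]|] /=; [have [] := nodeP (ltB i) (ltS i j)|rewrite (rt_c P)].
move=> [[i j]|] [[i' j']|] /=; last exact: adj_irr.
- have [nc _ _] := nodeP (ltB i) (ltS i j); have [nc' _ _] := nodeP (ltB i') (ltS i' j').
  rewrite adj_nc // !par_node_eq // -val_eqE [X in _ || X && _]eq_sym -andb_orr.
  by rewrite [X in _ = _ && X]orbC.
- rewrite adj_sym; have [nc _ _] := nodeP (ltB i) (ltS i j); rewrite adj_root_nc //.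
  move: (ltS i j) nc; case: (nat_of_ord j) => [|k] lt_k nc.
    by rewrite /node /=; have [_ ->] := topP (ltB i); rewrite !eqxx.
  rewrite par_node //; apply: contraTF v0c => /eqP<-.
  by have [] := nodeP (ltB i) (ltnW lt_k).
have [nc _ _] := nodeP (ltB i') (ltS i' j'); rewrite adj_root_nc //.
move: (ltS i' j') nc; case: (nat_of_ord j') => [|k] lt_k nc.
  by rewrite /node /=; have [_ ->] := topP (ltB i'); rewrite !eqxx.
rewrite par_node //; apply: contraTF v0c => /eqP<-.
by have [] := nodeP (ltB i') (ltnW lt_k).
Qed.

End Star.
End Gluing.

(** * Competitors *)

Lemma sum_ord_geq a b : \sum_(i < b) (a <= i) = b - a.
Proof. by elim: b => [|b IHb]; rewrite ?big_ord0 // big_ord_recr /= IHb; lia. Qed.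

Lemma sum_ord_ltn a b : \sum_(i < b) (i < a) = minn a b.
Proof. by elim: b => [|b IHb]; rewrite ?big_ord0 ?big_ord_recr /= ?IHb; lia. Qed.

Lemma sum_ord_eq a b : \sum_(i < b) (i == a :> nat) = (a < b).
Proof. by elim: b => [|b IHb]; rewrite ?big_ord0 ?big_ord_recr /= ?IHb; lia. Qed.

(** A cycle of length [m + 3] with [N] further vertices, where [pf] gives the parent of each. As a
    parent off the cycle has a smaller index, the index serves as rank. *)
Section Attach.
Variables (m N : nat) (pf : 'I_N -> 'I_m.+3 + 'I_N).
Hypothesis pf_lt : forall i k, pf i = inr k -> k < i.

Definition att_cyc : seq ('I_m.+3 + 'I_N) := [seq inl i | i <- enum 'I_m.+3].
Definition att_par (v : 'I_m.+3 + 'I_N) := if v is inr i then pf i else v.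
Definition att_rank (v : 'I_m.+3 + 'I_N) := if v is inr i then (nat_of_ord i).+1 else 0.

Lemma mem_att_cyc v : (v \in att_cyc) = if v is inl _ then true else false.
Proof.
case: v => i; first by rewrite mem_map ?mem_enum // => x y [].
by apply/negbTE/mapP => [] [].
Qed.

Lemma size_att_cyc : size att_cyc = m.+3.
Proof. by rewrite size_map size_enum_ord. Qed.

Lemma index_att_cyc i : index (inl i) att_cyc = i.
Proof. by rewrite index_map ?index_enum_ord // => x y []. Qed.

Lemma att_cyc_uniq : uniq att_cyc.
Proof. by rewrite map_inj_uniq ?enum_uniq // => x y []. Qed.

Lemma att_rank_lt v : v \notin att_cyc -> att_rank (att_par v) < att_rank v.
Proof.
rewrite mem_att_cyc; case: v => // i _ /=.
by case e: (pf i) => [k|k] //=; rewrite ltnS (pf_lt e).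
Qed.

Lemma att_irr : irreflexive (padj att_cyc att_par).
Proof.
move=> v; rewrite /padj /cadj orbb orbb; case: (boolP (v \in _)) => /= vc.
  rewrite orbF eq_sym; apply/negbTE; apply: next_neq vc; first exact: att_cyc_uniq.
  by rewrite size_att_cyc.
by apply/eqP => e; have := att_rank_lt vc; rewrite -e ltnn.
Qed.

Definition attach : sgraph := SGraph (@padj_sym _ att_cyc att_par) att_irr.

Lemma attach_presentation : presentation (@adj attach) att_cyc att_par att_rank.
Proof.
split=> //; [exact: att_cyc_uniq|by rewrite size_att_cyc| |exact: att_rank_lt].
by move=> v; rewrite mem_att_cyc; case: v.
Qed.
Let P := attach_presentation.

Lemma card_attach : #|attach| = m.+3 + N.
Proof. by rewrite card_sum !card_ord. Qed.

Lemma card_att_ncyc : #|[pred x : attach | x \notin att_cyc]| = N.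
Proof. by have := cyc_ncyc P; rewrite card_attach size_att_cyc => /addnI. Qed.

Lemma sum_att (F : attach -> nat) :
  \sum_(v : attach) F v = \sum_(i < m.+3) F (inl i) + \sum_(i < N) F (inr i).
Proof. by rewrite big_sumType. Qed.

Lemma sum_att_ncyc (F : attach -> nat) :
  \sum_(v | v \notin att_cyc) F v = \sum_(i < N) F (inr i).
Proof.
rewrite big_mkcond sum_att big1 => [|i _]; last by rewrite mem_att_cyc.
by rewrite add0n; apply: eq_bigr => i _; rewrite mem_att_cyc.
Qed.

Lemma card_att_children (v : attach) :
  #|@children attach att_cyc att_par v| = \sum_(i < N) (pf i == v).
Proof.
rewrite -(sum_att_ncyc (fun w => att_par w == v)) -sum1_card [LHS]big_mkcond.
rewrite [RHS]big_mkcond; apply: eq_bigr => w _; rewrite in_set.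
by case: (w \in _); case: (_ == v).
Qed.

Lemma card_att_odd : #|oddv attach| =
  \sum_(i < m.+3) odd (\sum_(k < N) (pf k == inl i))
  + \sum_(i < N) ~~ odd (\sum_(k < N) (pf k == inr i)).
Proof.
rewrite -sum1_card big_mkcond sum_att; congr (_ + _); apply: eq_bigr => i _;
  rewrite in_set (degreeE P) mem_att_cyc oddD card_att_children /=.
  by rewrite addbF; case: (odd _).
by rewrite addbT; case: (odd _).
Qed.

Lemma attach_in_U r : #|oddv attach| + r = m.+3 + N -> in_U (m.+3 + N) r attach.
Proof.
move=> e; split; [exact: pres_unicyclic P|exact: card_attach|].
have -> : [set v : attach | ~~ odd (degree v)] = ~: oddv attach.
  by apply/setP => v; rewrite !in_set.
have := cardsC (oddv attach); rewrite card_attach -e.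
exact: addnI.
Qed.

Lemma att_dcyc i k : dcyc att_cyc (inl i) (inl k) = cdist m.+3 i k.
Proof. by rewrite /dcyc !index_att_cyc size_att_cyc. Qed.

End Attach.

(** * First competitor: balanced branches at one cycle vertex *)

Section BranchWitness.
Variables (m N q : nat).
Hypotheses (q0 : 0 < q) (qN : q <= N) (oq : ~~ odd q).

(* The branches at vertex 0 of the cycle are the residue classes modulo [q]. *)
Definition br_par (i : 'I_N) : 'I_m.+3 + 'I_N :=
  if i < q then inl ord0 else inr (Ordinal (leq_ltn_trans (leq_subr q i) (ltn_ord i))).

Lemma br_lt i k : br_par i = inr k -> k < i.
Proof. by rewrite /br_par; case: ltnP => // le_q [<-] /=; lia. Qed.

Definition br_graph := attach br_lt.
Let P := attach_presentation br_lt.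

Lemma br_par_inl i k : (br_par i == inl k) = (i < q) && (k == ord0).
Proof.
rewrite /br_par; case: ltnP => //= _; rewrite eq_sym.
by apply/eqP/eqP => [[]|->].
Qed.

Lemma br_par_inr i k : (br_par i == inr k) = (i == k + q :> nat).
Proof.
rewrite /br_par; case: ltnP => [lt_q|le_q]; first by apply/esym/negbTE; lia.
apply/eqP/eqP => [[<-] /=|e]; first lia.
by congr inr; apply: val_inj; rewrite /= e addnK.
Qed.

(** The odd vertices are the [q] leaves, those [i] with [N <= i + q]: inner vertices of branches
    have degree 2, and vertex 0 of the cycle has an even number [q] of children. *)
Lemma br_odd : #|oddv br_graph| = q.
Proof.
rewrite card_att_odd [X in X + _]big1 => [|i _]; last first.
  have -> : \sum_(k < N) (br_par k == inl i) = (i == ord0) * q.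
    rewrite -[in RHS](minn_idPl qN) -sum_ord_ltn big_distrr /=; apply: eq_bigr => k _.
    by rewrite br_par_inl andbC; case: (i == _); rewrite ?mul1n.
  by case: (i == _); rewrite ?mul1n ?(negPf oq).
rewrite add0n -[RHS](subKn qN) -sum_ord_geq; apply: eq_bigr => i _.
have -> : \sum_(k < N) (br_par k == inr i) = (i + q < N).
  by rewrite -sum_ord_eq; apply: eq_bigr => k _; rewrite br_par_inr.
by rewrite oddb -leqNgt leq_subLR addnC.
Qed.

Lemma br_in_U : in_U (m.+3 + N) (m.+3 + N - q) br_graph.
Proof. by apply: attach_in_U; rewrite br_odd subnKC //; lia. Qed.

Lemma br_desc i (v : br_graph) : v \in desc (att_par br_par) (inr i : br_graph) ->
  exists2 j : 'I_N, v = inr j & exists t, j = i + q * t :> nat.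
Proof.
case/descP => a; elim: a v => [|a IHa] v.
  by move=> /= ->; exists i => //; exists 0; rewrite muln0 addn0.
rewrite iterSr => /IHa[k e [t et]]; case: v e => //= j e; exists j => //.
by exists t.+1; move/eqP: e; rewrite br_par_inr => /eqP->; rewrite et mulnS; lia.
Qed.

Lemma br_card_desc i k : k < #|desc (att_par br_par) (inr i : br_graph)| -> i + q * k < N.
Proof.
apply: contraLR; rewrite -!leqNgt => le_N; rewrite cardE.
(* Reads off [t] from the descendant [i + q * t]; these numbers are below [k] when [i + q * k] is
   out of range. *)
pose g (v : br_graph) := if v is inr j then (j - i) %/ q else 0.
rewrite -(size_iota 0 k) -(size_map g); apply: uniq_leq_size.
  rewrite map_inj_in_uniq ?enum_uniq // => v w.
  rewrite !mem_enum => /br_desc[j -> [t et]] /br_desc[j' -> [t' et']] /=.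
  rewrite et et' !addKn !mulKn // => e; congr inr; apply: val_inj.
  by rewrite /= et et' e.
move=> x /mapP[v]; rewrite mem_enum => /br_desc[j -> [t et]] -> /=.
rewrite et addKn mulKn // mem_iota /= add0n -(ltn_pmul2l q0).
by have := ltn_ord j; rewrite et; lia.
Qed.

Lemma br_rt (v : br_graph) : v \notin att_cyc m N ->
  rt (att_par br_par) (@att_rank m N) v = inl ord0.
Proof.
elim/(par_ind P): v => v vc; first by rewrite vc.
move=> IH _; rewrite -(rt_par P); have [pc|pc] := boolP (att_par br_par v \in att_cyc m N).
  rewrite (rt_c P pc); move: vc pc; rewrite !mem_att_cyc; case: v {IH} => //= i _.
  by rewrite /br_par; case: ifP.
exact: IH.
Qed.

Lemma br_wiener : (wiener br_graph).*2 <=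
  (star_cut (m.+3 + N) N q).*2 + (m.+3 + N.*2) * csum m.+3.
Proof.
have nE := card_attach br_lt.
rewrite (wienerE P) -[leqRHS]addn0 size_att_cyc (card_att_ncyc br_lt).
apply: leq_add; last first.
  rewrite big1 // => u uc; rewrite big1 // => v vc.
  by rewrite !br_rt // /dcyc /cdist subnn min0n.
rewrite leq_add2r leq_double nE (sum_cutE P nE) /star_cut; apply: leq_sum => k _.
rewrite leq_mul2r; apply/orP; right.
(* A bridge with more than [k] vertices on its smaller side has more than [k] descendants, so
   [i + q * k] is in range; this leaves [N - q * k] values of [i]. *)
apply: leq_trans (_ : \sum_(i < N) (i + q * k < N) <= _).
  rewrite -(@sum_att_ncyc _ _ _ br_lt (fun v => if v is inr i then i + q * k < N else false)).
  rewrite /above -sum1_card [leqLHS]big_mkcond [leqRHS]big_mkcond /=; apply: leq_sum => v _.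
  rewrite in_set; case: (boolP (v \in _)) => //=; rewrite mem_att_cyc; case: v => // i _.
  case: ltnP => // lt_k; rewrite (br_card_desc (k := k)) //; apply: leq_trans lt_k _.
  by rewrite (card_side P nE) geq_minl.
have -> : \sum_(i < N) (i + q * k < N) = minn (N - q * k) N.
  by rewrite -sum_ord_ltn; apply: eq_bigr => i _; rewrite ltn_subRL addnC.
exact: geq_minl.
Qed.

End BranchWitness.

(** * Second competitor: a triangle with pendant vertices *)

Section PendantWitness.
Variables (N j : nat).
Hypotheses (j2 : j <= 2) (jN : j < N) (oNj : odd (N - j)).

(* The first [j] pendant vertices go to the vertices 1, ..., [j] of the triangle,
   the others to 0. *)
Definition pd_root (i : nat) : nat := if i < j then i.+1 else 0.

Lemma pd_root_lt i : pd_root i < 3.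
Proof. by rewrite /pd_root; case: (ltnP i j); lia. Qed.

Definition pd_par (i : 'I_N) : 'I_3 + 'I_N := inl (Ordinal (pd_root_lt i)).

Lemma pd_lt i k : pd_par i = inr k -> k < i.
Proof. by []. Qed.

Definition pd_graph := attach pd_lt.
Let P := attach_presentation pd_lt.

(** The odd vertices are the [N] leaves, the [j] triangle vertices with one leaf each, and vertex 0
    with its odd number [N - j] of leaves. *)
Lemma pd_odd : #|oddv pd_graph| = N + j.+1.
Proof.
rewrite card_att_odd [X in _ + X](eq_bigr (fun _ => 1)) => [|i _]; last by rewrite big1.
rewrite sum_nat_const card_ord muln1 addnC; congr (_ + _).
have E (i : 'I_3) : \sum_(k < N) (pd_par k == inl i) =
    if i == 0 :> nat then N - j else (i <= j).
  transitivity (\sum_(k < N) (pd_root k == i)).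
    exact: eq_bigr.
  rewrite /pd_root; case: eqP => [->|/eqP i0].
    by rewrite -sum_ord_geq; apply: eq_bigr => k _; case: ltnP.
  case: leqP => [le_j|lt_j]; last by rewrite big1 // => k _; case: ltnP => ?; lia.
  transitivity (\sum_(k < N) (k == i.-1 :> nat)); last by rewrite sum_ord_eq; lia.
  by apply: eq_bigr => k _; case: ltnP => ?; lia.
by rewrite !big_ord_recl big_ord0 !E /= oNj /bump /=; case: (j) j2 => [|[|[|]]].
Qed.

Lemma pd_in_U : in_U (3 + N) (2 - j) pd_graph.
Proof. by apply: attach_in_U; rewrite pd_odd; lia. Qed.

Lemma pd_rt (i : 'I_N) :
  rt (att_par pd_par) (@att_rank 0 N) (inr i : pd_graph) = inl (Ordinal (pd_root_lt i)).
Proof. by rewrite -(rt_par P) (rt_c P) ?mem_att_cyc. Qed.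

Lemma pd_card_desc (i : 'I_N) : #|desc (att_par pd_par) (inr i : pd_graph)| = 1.
Proof.
have ic : (inr i : pd_graph) \notin att_cyc 0 N by rewrite mem_att_cyc.
apply: etrans (cards1 (inr i : pd_graph)); apply: eq_card => v.
rewrite in_set1 (descE _ v) orbC; case: v => [k|k].
  by rewrite (negPf (desc_cyc P _ ic)) ?mem_att_cyc.
by rewrite (negPf (desc_cyc P _ ic)) ?mem_att_cyc.
Qed.

Lemma sum_pd_root : \sum_(i < N) \sum_(k < N) (pd_root i != pd_root k) =
  j * (N - 1) + (N - j) * j.
Proof.
have E (i : 'I_N) : \sum_(k < N) (pd_root i != pd_root k) =
    (i < j) * (N - 1) + (j <= i) * j.
  case: ltnP => [lt_ij|le_ji]; rewrite ?mul1n ?mul0n ?addn0 ?add0n.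
    rewrite (bigD1 i) //= eqxx add0n (eq_bigr (fun _ => 1)) => [|k].
      by rewrite sum_nat_const cardC1 card_ord muln1 subn1.
    by rewrite /pd_root lt_ij -val_eqE /=; case: (ltnP k j); lia.
  rewrite -[RHS](minn_idPl (ltnW jN)) -sum_ord_ltn; apply: eq_bigr => k _.
  by rewrite /pd_root ltnNge le_ji /=; case: (ltnP k j).
rewrite (eq_bigr _ (fun i _ => E i)) big_split /= -!big_distrl /= sum_ord_ltn sum_ord_geq.
by rewrite (minn_idPl (ltnW jN)).
Qed.

Lemma pd_wiener : (wiener pd_graph).*2 =
  (N * (N + 2)).*2 + (3 + N.*2) * csum 3 + (j * (N - 1) + (N - j) * j).
Proof.
rewrite (wienerE P) size_att_cyc (card_att_ncyc pd_lt); congr (_.*2 + _ + _).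
  rewrite (@sum_att_ncyc _ _ _ pd_lt) (eq_bigr (fun _ => N + 2)) => [|i _].
    by rewrite sum_nat_const card_ord.
  by rewrite pd_card_desc (card_attach pd_lt); lia.
rewrite -sum_pd_root (@sum_att_ncyc _ _ _ pd_lt); apply: eq_bigr => i _.
rewrite (@sum_att_ncyc _ _ _ pd_lt); apply: eq_bigr => k _; rewrite !pd_rt att_dcyc /= /cdist.
by have := pd_root_lt i; have := pd_root_lt k; case: eqP; lia.
Qed.

End PendantWitness.

(** * Comparison of the bounds *)

(* Twice the Wiener index of the [l]-cycle with [n - l] pendant vertices at one
   vertex. *)
Definition pendant_bound n l := ((n - l) * (n - 1)).*2 + (n.*2 - l) * csum l.

Lemma csum_double a : csum a.*2 = a * a.
Proof. by have := csumE a.*2; rewrite odd_double addn0; nia. Qed.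

Lemma csum_doubleS a : csum a.*2.+1 = a * a + a.
Proof. by have := csumE a.*2.+1; rewrite /= odd_double; nia. Qed.

Lemma pendant_boundS n l : 2 < l -> l < n ->
  pendant_bound n l + (n - l.+1).*2 <= pendant_bound n l.+1 + (l == 4).*2.
Proof.
move=> l3 ln; have [d ->] : exists d, n = l.+1 + d by exists (n - l.+1); lia.
rewrite /pendant_bound.
have -> : l.+1 + d - l = d.+1 by lia.
have -> : l.+1 + d - l.+1 = d by lia.
have -> : l.+1 + d - 1 = l + d by lia.
have -> : (l.+1 + d).*2 - l = l + 2 + d.*2 by lia.
have -> : (l.+1 + d).*2 - l.+1 = l + 1 + d.*2 by lia.
have [a [e|e]] : exists a, l = a.*2 \/ l = a.*2.+1 by exists l./2; lia.
  have [a2|a3] := leqP a 2.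
    have ->: l = 4 by lia.
    by rewrite (csum_double 2) (csum_doubleS 2) /=; lia.
  have [b ->] : exists b, l = (b + 3).*2 by exists (a - 3); lia.
  rewrite csum_double csum_doubleS -!mul2n; nia.
have [b ->] : exists b, l = b.+1.*2.+1 by exists a.-1; lia.
have -> : b.+1.*2.+2 = b.+2.*2 by lia.
rewrite csum_double csum_doubleS -!mul2n; nia.
Qed.

Lemma pendant_bound_lt n r l : n != 6 -> 2 < r -> r < l -> l < n ->
  pendant_bound n r < pendant_bound n l.
Proof.
move=> n6 r3; elim: l => // l IHl; rewrite ltnS leq_eqVlt => /orP[/eqP<-|rl] ln.
  by have := pendant_boundS r3 (ltnW ln); case: eqP; lia.
have := IHl rl (ltnW ln); have := pendant_boundS (ltn_trans r3 rl) (ltnW ln).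
by case: eqP; lia.
Qed.

(** The second hypothesis is [l <= N + r] with [r = 2 - j]. From [l = 3] to 4 the growth [2 (n - 4)]
    exceeds [(n - 3 - j) * j]; each later step loses only [j] on the right. *)
Lemma pendant_bound_gap n l j : 3 < l -> l.*2 + j <= n + 2 -> j <= 2 ->
  pendant_bound n 3 + j * (n - 3 - 1) + (n - 3 - j) * j < pendant_bound n l + (n - l) * j.
Proof.
elim: l => // l IHl; rewrite ltnS leq_eqVlt => /orP[/eqP<-|l3] le_n le_j.
  have := @pendant_boundS n 3 isT; case: j le_n le_j {IHl} => [|[|[|]]] // *; lia.
have := IHl l3; have := @pendant_boundS n l (ltnW l3).
have : (l == 4) <= 1 by case: eqP.
case: j le_n le_j {IHl} => [|[|[|]]] // *; lia.
Qed.

(** Sizes of the trees at a triangle, of which at most [2 - j] may be trivial. The sum is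
    [2 (ab + ad + bd)], and moving a vertex from a smaller class to the largest lowers it, so the
    minimum has [j] singletons beside the class [a]. *)
Lemma classes_bound (j a b d : nat) : j <= 2 -> b <= a -> d <= a -> 0 < a + b + d ->
  (a == 0) + (b == 0) + (d == 0) + j <= 2 ->
  j * (a + b + d - 1) + (a + b + d - j) * j <= a * (b + d) + b * (a + d) + d * (a + b)
  /\ (a * (b + d) + b * (a + d) + d * (a + b) <= j * (a + b + d - 1) + (a + b + d - j) * j ->
      [/\ b <= 1, d <= 1 & b + d = j]).
Proof.
case: a => [|a]; first lia.
case: j => [|[|[|]]] // _.
- by case: b => [|b]; case: d => [|d] *; split=> // *; try split; nia.
- by case: b => [|b]; case: d => [|d] *; split=> // *; try split; nia.
by case: b => [|b]; case: d => [|d] *; split=> // *; try split; nia.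
Qed.

(** * Off-cycle vertices grouped by their root *)

Section Classes.
Variables (G : sgraph) (c : seq G) (par : G -> G) (h : G -> nat).
Hypothesis P : presentation (@adj G) c par h.
Let Uc := pres_uniq P.
Let sc := pres_size P.
Local Notation desc := (desc par).
Local Notation rt := (rt par h).
Local Notation s w := #|desc w|.
Variable N : nat.
Hypothesis NE : #|[pred x | x \notin c]| = N.

Definition hanging x : {set G} := [set u | (u \notin c) && (rt u == x)].

Lemma sum_hanging : \sum_(x <- c) #|hanging x| = N.
Proof.
rewrite big_uniq //= -NE -[RHS]sum1_card [RHS](partition_big rt (mem c)) => [|u _]; last first.
  exact: rt_mem P _.
apply: eq_bigr => x xc; rewrite -sum1_card; apply: eq_bigl => u.
by rewrite in_set.
Qed.

Lemma hanging_le x : #|hanging x| <= N.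
Proof. by rewrite -NE; apply: subset_leq_card; apply/subsetP => u; rewrite !inE => /andP[]. Qed.

Lemma sum_rt_neq :
  \sum_(u | u \notin c) \sum_(v | v \notin c) (rt u != rt v)
  = \sum_(x <- c) #|hanging x| * (N - #|hanging x|).
Proof.
have E u : \sum_(v | v \notin c) (rt u != rt v) = N - #|hanging (rt u)|.
  apply/eqP; rewrite -(eqn_add2r #|hanging (rt u)|) subnK ?hanging_le // -NE.
  rewrite -!sum1_card [X in _ + X]big_mkcond [X in X + _]big_mkcond -big_split /=.
  rewrite [X in _ == X]big_mkcond /=; apply/eqP; apply: eq_bigr => v _.
  by rewrite in_set inE eq_sym; case: (v \in c) => //=; case: (_ == _).
rewrite big_uniq //= [LHS](partition_big rt (mem c)) => [|u _]; last exact: rt_mem P _.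
apply: eq_bigr => x xc; rewrite -sum1_card big_distrl /=.
apply: eq_big => [u|u /andP[_ /eqP<-]]; first by rewrite in_set.
by rewrite E mul1n sum1_card.
Qed.

Lemma dcyc_neq x y : x \in c -> y \in c -> (x != y) <= dcyc c x y.
Proof.
move=> xc yc; have [//|ne] := eqVneq x y.
have ix := xc; rewrite -index_mem in ix; have iy := yc; rewrite -index_mem in iy.
apply: cdist_gt0 => // e; case/eqP: ne.
by rewrite -(nth_index x xc) e nth_index.
Qed.

Lemma sum_dcyc_ge :
  \sum_(x <- c) #|hanging x| * (N - #|hanging x|) <=
  \sum_(u | u \notin c) \sum_(v | v \notin c) dcyc c (rt u) (rt v).
Proof.
rewrite -sum_rt_neq; apply: leq_sum => u _; apply: leq_sum => v _.
by apply: dcyc_neq; apply: rt_mem P _.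
Qed.

Lemma hanging0_even x : x \in c -> #|hanging x| = 0 -> ~~ odd (degree x).
Proof.
move=> xc /eqP; rewrite cards_eq0 => /eqP e; rewrite (degreeE P) xc oddD addbF.
rewrite (_ : children _ _ _ = set0) ?cards0 //; apply/eqP; rewrite -subset0 -e.
by apply/subsetP => w; rewrite !in_set => /andP[-> /eqP pw]; rewrite -(rt_par P) pw (rt_c P) ?eqxx.
Qed.

Lemma sum_hanging0 : \sum_(x <- c) (#|hanging x| == 0) <= #|[set v : G | ~~ odd (degree v)]|.
Proof.
rewrite big_uniq //= -sum1_card big_mkcond [leqRHS]big_mkcond /=; apply: leq_sum => x _.
rewrite in_set; case: ifP => // xc; case: eqP => //= e.
by rewrite hanging0_even.
Qed.

(** At most [r] cycle vertices carry no tree, so at least [size c - r - 1] vertices other than [x]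
    carry one, each with a vertex of its own. *)
Lemma card_roots r : #|[set v : G | ~~ odd (degree v)]| = r ->
  forall x, (size c - r).-1 + #|hanging x| <= N \/ N = 0.
Proof.
move=> rE x; have := sum_hanging0; rewrite rE.
have := sum_hanging.
have F y : 0 < #|hanging y| + (#|hanging y| == 0) by case: eqP; lia.
have [xc|xc] := boolP (x \in c); last first.
  have -> : #|hanging x| = 0.
    apply/eqP; rewrite cards_eq0; apply/eqP/setP => u; rewrite !inE.
    by apply: contraNF xc => /andP[_ /eqP<-]; apply: rt_mem P _.
  have : size c <= \sum_(y <- c) (#|hanging y| + (#|hanging y| == 0)).
    by rewrite -sum1_size; apply: leq_sum.
  by rewrite big_split /=; lia.
rewrite !(bigD1_seq x xc Uc) /=.
have : (size c).-1 <= \sum_(y <- c | y != x) (#|hanging y| + (#|hanging y| == 0)).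
  have : \sum_(y <- c) 1 = size c by rewrite sum1_size.
  rewrite (bigD1_seq x xc Uc) /= => <-; apply: leq_sum => y _; exact: F.
by rewrite big_split /=; case: eqP; lia.
Qed.

Lemma size_le_roots r : #|[set v : G | ~~ odd (degree v)]| = r -> size c <= N + r.
Proof.
move=> rE; have := sum_hanging0; rewrite rE; have := sum_hanging.
have : size c <= \sum_(y <- c) (#|hanging y| + (#|hanging y| == 0)).
  by rewrite -sum1_size; apply: leq_sum => y _; case: eqP; lia.
by rewrite big_split /=; lia.
Qed.

Variable n : nat.
Hypothesis nE : #|G| = n.

(** The difference of the two sides is [(s w - 1) (n - s w - 1)], and [s w <= n - 3] because
    descendants avoid the cycle. *)
Lemma cut_ge w : w \notin c -> n - 1 <= s w * (n - s w).
Proof.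
move=> wc; have := desc_gt0 par w; have := card_desc_cyc P nE wc.
move: sc; set l := size c; set k := #|_|; move: l k; clear; move=> l [|k] // l3 le_n _.
have [d ->] : exists d, n = k.+1 + d.+1 by exists (n - k.+1).-1; lia.
by rewrite addKn; nia.
Qed.

Lemma cut_eq w : w \notin c -> s w * (n - s w) <= n - 1 -> s w = 1.
Proof.
move=> wc; have := desc_gt0 par w; have := card_desc_cyc P nE wc.
move: sc; set l := size c; set k := #|_|; move: l k; clear; move=> l [|k] // l3 le_n _.
have [d ->] : exists d, n = k.+1 + d.+2 by exists (n - k.+1).-2; lia.
by rewrite addKn; nia.
Qed.

Lemma sum_cut_pendant : N * (n - 1) <= \sum_(w | w \notin c) s w * (n - s w).
Proof.
rewrite -NE -sum_nat_const; apply: leq_sum => w; exact: cut_ge.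
Qed.

Lemma sum_cut_pendant_eq : \sum_(w | w \notin c) s w * (n - s w) <= N * (n - 1) ->
  forall w, w \notin c -> s w = 1.
Proof.
move=> le w wc; apply: cut_eq => //; rewrite leqNgt; apply/negP => gt.
move: le; rewrite leqNgt => /negP; apply; rewrite -NE -sum_nat_const.
rewrite (bigD1 w) //= [ltnRHS](bigD1 w) //= -addSn; apply: leq_add => //.
by apply: leq_sum => v /andP[vc _]; apply: cut_ge.
Qed.

End Classes.

(** Rotates the cycle so that a largest tree comes first, as the first argument of [H_of]. *)
Lemma max_presentation (G : sgraph) : unicyclic G ->
  exists x0 c par h, presentation (@adj G) (x0 :: c) par h /\
    forall y, #|hanging (x0 :: c) par h y| <= #|hanging (x0 :: c) par h x0|.
Proof.
move=> /unicyclic_presentation[c [par [h P]]].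
have [x xc] : exists x, x \in c.
  by have := pres_size P; case: (c) => // x l _; exists x; rewrite mem_head.
case: (arg_maxnP (fun y => #|hanging c par h y|) xc) => x0 x0c max.
have [i c' ec] := rot_to x0c; exists x0, c', par, h; rewrite -ec.
split=> [|y]; first exact: rot_presentation P i.
have eh z : #|hanging (rot i c) par h z| = #|hanging c par h z|.
  by apply: eq_card => u; rewrite !in_set mem_rot.
rewrite !eh; have [/max//|yc] := boolP (y \in c).
rewrite (_ : hanging _ _ _ _ = set0) ?cards0 //; apply/setP => u; rewrite !inE.
by apply: contraNF yc => /andP[_ /eqP<-]; apply: rt_mem P _.
Qed.

(** * Extremal graphs *)

Section Roots.
Variables (G : sgraph) (c : seq G) (par : G -> G) (h : G -> nat).
Hypothesis P : presentation (@adj G) c par h.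
Local Notation desc := (desc par).
Local Notation rt := (rt par h).
Local Notation s w := #|desc w|.

Lemma leaf_no_child w v : s w = 1 -> w \notin c -> v \notin c -> par v <> w.
Proof.
move=> s1 wc vc pv; have vw : v \in desc w by rewrite (descE par v w) pv desc_refl orbT.
have ne : v != w.
  by apply: contraFneq (ltnn (h v)) => e; rewrite -{1}pv in e; rewrite {1}e (pres_rank P).
have : [set v; w] \subset desc w by rewrite subUset !sub1set vw desc_refl.
by move/subset_leq_card; rewrite cards2 ne s1.
Qed.

Lemma leaf_par w : (forall v, v \notin c -> s v = 1) -> w \notin c -> par w = rt w.
Proof.
move=> s1 wc; rewrite -(rt_par P); have [pc|pc] := boolP (par w \in c); first by rewrite (rt_c P).
by have := leaf_no_child (s1 _ pc) pc wc.
Qed.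

Lemma tree_at_small y : (forall v, v \notin c -> s v = 1) -> y \in c ->
  #|hanging c par h y| <= 1 -> tree_at par h (if #|hanging c par h y| == 0 then K1 else K2) y.
Proof.
move=> s1 yc; rewrite leq_eqVlt ltnS leqn0 => /orP[/cards1P[w e]|/[dup] A0 ->]; last first.
  apply: (tree_at_K1 P yc) => u uc; apply: contraTneq A0 => ru.
  by rewrite -lt0n; apply/card_gt0P; exists u; rewrite in_set uc ru eqxx.
rewrite e cards1 /=; have : w \in hanging c par h y by rewrite e set11.
rewrite in_set => /andP[wc /eqP rw].
apply: (tree_at_K2 P yc wc); first by rewrite leaf_par.
move=> u uc ru; apply/set1P; rewrite -e in_set uc ru eqxx.
by [].
Qed.

Lemma tree_at_pendant y : (forall v, v \notin c -> s v = 1) -> y \in c ->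
  tree_at par h (SB 1 #|hanging c par h y|) y.
Proof.
move=> s1 yc; have -> : SB 1 #|hanging c par h y| = subdivided_star (branch_lengths c par y).
  congr subdivided_star; rewrite /branch_lengths.
  have -> : children c par y = hanging c par h y.
    apply/setP => w; rewrite !in_set; case: (boolP (w \in c)) => //= wc.
    by rewrite leaf_par.
  rewrite cardE; have : {in enum (hanging c par h y), forall w, s w = 1}.
    by move=> w; rewrite mem_enum in_set => /andP[/s1].
  elim: (enum _) => //= w l IHl s1l; rewrite s1l ?mem_head // IHl // => v vl.
  by rewrite s1l // inE vl orbT.
apply: (tree_at_star P yc) => w v wc _ vc pv.
by case: (leaf_no_child (s1 w wc) wc vc pv).
Qed.

End Roots.

Lemma star_cut_pendant n p : 1 < n -> star_cut n p p = p * (n - 1).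
Proof.
move=> n2; rewrite /star_cut; have [m ->] : exists m, n./2 = m.+1 by exists n./2.-1; lia.
rewrite big_ord_recl /= muln0 !subn0 big1 ?addn0 // => i _.
by rewrite (_ : p - p * bump 0 i = 0) // /bump /= mulnDr muln1 addnC; lia.
Qed.

Section Extremal.
Variables (n r : nat) (G : sgraph).
Hypothesis hG : in_U n r G.
Hypothesis hmin : forall G' : sgraph, in_U n r G' -> wiener G <= wiener G'.

Lemma card_oddv : #|oddv G| + r = n.
Proof.
case: hG => _ <- <-; rewrite -(cardsC (oddv G)); congr (_ + _).
by apply: eq_card => v; rewrite !in_set.
Qed.

Lemma extremal_few_even : r <= 2 ->
  exists (b1 : nat) (X1 X2 : rooted_graph),
    [/\ odd b1, X1 = K1 \/ X1 = K2, X2 = K1 \/ X2 = K2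
      & isomorphic G (H_of [:: SB 1 b1; X1; X2])].
Proof.
move=> r2; have [uG nE rE] := hG; have pE := card_oddv.
have [x0 [c [par [h [P max]]]]] := max_presentation uG.
set C := x0 :: c in P max *.
have [N NE] : {N | #|[pred x | x \notin C]| = N} by eexists.
have [l lE] : {l | size C = l} by eexists.
have l3 : 2 < l by rewrite -lE (pres_size P).
have nlN : l + N = n by rewrite -lE -NE (cyc_ncyc P).
have lNr : l <= N + r by rewrite -lE; apply: (size_le_roots P NE rE).
have op := odd_oddv P.
(* The competitor is [pd_graph] with [j] pendant vertices away from vertex 0; it has [2 - j = r]
   even vertices. *)
pose j := 2 - r.
have WG := wienerE P; rewrite nE NE lE in WG.
have Zge := sum_dcyc_ge P NE.
have cutge := sum_cut_pendant P NE nE.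
set Z := (X in _ = _ + X) in WG; rewrite -/Z in Zge.
set S := \sum_(w | _) _ in WG; rewrite -/S in cutge.
have Wle : (wiener G).*2 <= pendant_bound n 3 + j * (n - 3 - 1) + (n - 3 - j) * j.
  have j2 : j <= 2 by rewrite /j; lia.
  have jN : j < n - 3 by rewrite /j; lia.
  have oNj : odd (n - 3 - j) by move: op; rewrite /j -pE; lia.
  have := pd_in_U j2 jN oNj; rewrite (_ : 3 + (n - 3) = n); last lia.
  rewrite (_ : 2 - j = r); last by rewrite /j; lia.
  move/hmin; rewrite -leq_double (pd_wiener j2 jN) /pendant_bound => /leq_trans; apply.
  rewrite (_ : n - 3 + 2 = n - 1); last lia.
  by rewrite (_ : 3 + (n - 3).*2 = n.*2 - 3) ?addnA //; lia.
have Wge : pendant_bound n l + (S - N * (n - 1)).*2 + Z <= (wiener G).*2.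
  rewrite WG /pendant_bound (_ : n - l = N); last lia.
  rewrite (_ : l + N.*2 = n.*2 - l); last lia.
  by move: cutge; clear; lia.
have j2 : j <= 2 by rewrite /j; lia.
have [l4|l_eq] : 3 < l \/ l = 3 by lia.
  exfalso; have le_l : l.*2 + j <= n + 2 by rewrite /j; lia.
  have := pendant_bound_gap l4 le_l j2; rewrite (_ : n - l = N); last lia.
  (* As [l >= 4], at least [l - r - 1 >= j] vertices hang elsewhere than at any given [x]. *)
  have ZN : N * j <= Z.
    apply: leq_trans Zge; rewrite -[in leqLHS](sum_hanging P NE) big_distrl /=.
    apply: leq_sum => x _; rewrite leq_mul2l; apply/orP; right.
    by have [] := card_roots P NE rE x; rewrite ?lE /j; lia.
  by move: Wle Wge ZN; clear; lia.
have [y [z eC]] : exists y z, C = [:: x0; y; z].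
  by move: lE; rewrite l_eq /C; case: (c) => [|y [|z [|]]] // _; exists y, z.
have bigC (F : G -> nat) : \sum_(x <- C) F x = F x0 + (F y + F z).
  by rewrite eC !big_cons big_nil addn0.
have sumA := sum_hanging P NE; have sum0 := sum_hanging0 P.
rewrite rE bigC in sum0; rewrite bigC in sumA; rewrite bigC in Zge.
have yx := max y; have zx := max z.
set a := #|hanging C par h x0| in sumA sum0 Zge yx zx *.
set b := #|hanging C par h y| in sumA sum0 Zge yx *.
set d := #|hanging C par h z| in sumA sum0 Zge zx *.
have pos : 0 < a + b + d by move: sumA lNr r2 l3; clear; lia.
have zeros : (a == 0) + (b == 0) + (d == 0) + j <= 2 by move: sum0 r2; rewrite /j; clear; lia.
have [] := classes_bound j2 yx zx pos zeros.
have -> : a + b + d = N by move: sumA; clear; lia.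
have nN : n - 3 = N by move: nlN l_eq; clear; lia.
have aN : N - a = b + d by move: sumA; clear; lia.
have bN : N - b = a + d by move: sumA; clear; lia.
have dN : N - d = a + b by move: sumA; clear; lia.
rewrite aN bN dN in Zge; rewrite nN in Wle; rewrite l_eq in Wge => lo hi.
(* The bounds on the Wiener index force the product sum to its minimum, which fixes the class sizes;
   then the cut sum is minimal too and all off-cycle vertices are leaves. *)
have [|b1 d1 bd] := hi; first by move: Zge Wle Wge; clear; lia.
have s1 : forall v, v \notin C -> #|desc par v| = 1.
  apply: (sum_cut_pendant_eq P NE nE); rewrite -/S.
  by move: Zge Wle Wge lo; clear; lia.
exists a, (if b == 0 then K1 else K2), (if d == 0 then K1 else K2); split.
- by move: op pE bd sumA nlN l_eq r2; rewrite /j; clear; lia.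
- by case: ifP; [left|right].
- by case: ifP; [left|right].
have inC i : i < 3 -> nth x0 C i \in C by move=> ?; rewrite mem_nth // lE l_eq.
apply: (@H_of_isomorphic _ _ _ _ P x0); first by rewrite lE l_eq.
case=> [[|[|[|i]]] lt_i] //=.
- by apply: (tree_at_pendant P s1); apply: (inC 0).
- have -> : nth x0 c 0 = y by move: eC; rewrite /C => -[->].
  by apply: (tree_at_small P s1) b1; rewrite eC !inE eqxx orbT.
have -> : nth x0 c 1 = z by move: eC; rewrite /C => -[->].
by apply: (tree_at_small P s1) d1; rewrite eC !inE eqxx !orbT.
Qed.

Lemma extremal_many_even : 3 <= r ->
  isomorphic G (H_of [:: K2; K1; K1; K1; K1]) \/
  exists (b2 t k : nat) (S : rooted_graph),
    [/\ ~~ odd b2, is_SaB t b2 S, 2 <= k & isomorphic G (H_of (S :: nseq k K1))].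
Proof.
move=> r3; have [uG nE rE] := hG; have pE := card_oddv.
have [x0 [c [par [h [P max]]]]] := max_presentation uG.
set C := x0 :: c in P max *.
have [N NE] : {N | #|[pred x | x \notin C]| = N} by eexists.
have [l lE] : {l | size C = l} by eexists.
have [p pE'] : {p | #|oddv G| = p} by eexists.
have l3 : 2 < l by rewrite -lE (pres_size P).
have nlN : l + N = n by rewrite -lE -NE (cyc_ncyc P).
have op := odd_oddv P; rewrite pE' in op pE.
have x0C : x0 \in C by rewrite mem_head.
have WG := wienerE P; rewrite nE NE lE in WG.
set Z := (X in _ = _ + X) in WG; set S := \sum_(w | _) _ in WG.
(* If all off-cycle vertices share a root, it is [x0], since a largest tree hangs there. *)
have root_max u : u \notin C -> (forall v, v \notin C -> rt par h v = rt par h u) ->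
    rt par h u = x0.
  move=> uC same; have : 0 < #|hanging C par h (rt par h u)|.
    by apply/card_gt0P; exists u; rewrite in_set uC eqxx.
  move/leq_trans/(_ (max _)) => /card_gt0P[v]; rewrite in_set => /andP[vC /eqP <-].
  by rewrite same.
have iso_K1 T : tree_at par h T x0 -> (forall u, u \notin C -> rt par h u = x0) ->
    isomorphic G (H_of (T :: nseq l.-1 K1)).
  move=> T0 rt0; apply: (@H_of_isomorphic _ _ _ _ P x0).
    by rewrite lE /= size_nseq prednK // ltnW // ltnW.
  case=> [[|i] lt_i] //=; rewrite nth_nseq if_same.
  rewrite /= size_nseq in lt_i.
  have iC : i.+1 < size C by rewrite lE; move: lt_i l3; clear; lia.
  apply: (tree_at_K1 P); first by rewrite -[nth x0 c i]/(nth x0 C i.+1) mem_nth.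
  move=> u /rt0 ->; rewrite -[nth x0 c i]/(nth x0 C i.+1) -[x0 in X in X != _]/(nth x0 C 0).
  by rewrite nth_uniq ?(pres_uniq P).
have [Np|pN] := ltnP N p.
  left; have p0 : 0 < p by apply: leq_ltn_trans Np.
  have N0 : 0 < N.
    rewrite lt0n; apply/eqP => N0; move: (p0); rewrite -pE' => /card_gt0P[x].
    rewrite in_set; apply/negP; apply: (hanging0_even P).
      by apply: contraT => xC; move/eqP: NE; rewrite N0 => /pred0P/(_ x); rewrite /= xC.
    by apply/eqP; rewrite -leqn0 -N0; apply: (hanging_le par h NE).
  have rl : r < l by move: pE nlN Np; clear; lia.
  have ln : l < n by move: nlN N0; clear; lia.
  (* Here [r < l], and the competitor is the [r]-cycle with [p] pendant vertices at one vertex. *)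
  have Wle : pendant_bound n l <= pendant_bound n r.
    apply: leq_trans (_ : (wiener G).*2 <= _).
      rewrite WG /pendant_bound (_ : n - l = N); last by move: nlN; clear; lia.
      rewrite (_ : l + N.*2 = n.*2 - l); last by move: nlN; clear; lia.
      have := sum_cut_pendant P NE nE; rewrite -/S; clear; lia.
    have er : (r - 3).+3 + p = n by move: pE r3; clear; lia.
    have er' : (r - 3).+3 = r by move: r3; clear; lia.
    have := br_in_U (r - 3) p0 (leqnn p) op; rewrite er.
    rewrite (_ : n - p = r); last by move: pE; clear; lia.
    move/hmin; rewrite -leq_double => /leq_trans; apply.
    apply: leq_trans (br_wiener _ p0 (leqnn p) op) _.
    rewrite er er' star_cut_pendant; last by move: ln l3; clear; lia.
    rewrite /pendant_bound (_ : n - r = p); last by move: pE; clear; lia.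
    by rewrite (_ : r + p.*2 = n.*2 - r) //; move: pE; clear; lia.
  have n6 : n = 6.
    apply/eqP; apply: contraT => n6.
    by have := pendant_bound_lt n6 r3 rl ln; rewrite ltnNge Wle.
  (* From [3 <= r < l < 6] and [6 - r] even. *)
  have [r4 [l5 N1]] : r = 4 /\ l = 5 /\ N = 1.
    by move: n6 pE op rl ln nlN r3; clear; lia.
  have /card_gt0P[w wC] : 0 < #|[pred x | x \notin C]| by rewrite NE.
  have uw u : u \notin C -> u = w.
    by move=> uC; have /card_le1_eqP := eq_leq (etrans NE N1); apply.
  have rw : rt par h w = x0 by apply: root_max => // v /uw ->.
  have -> : [:: K2; K1; K1; K1; K1] = K2 :: nseq l.-1 K1 by rewrite l5.
  apply: iso_K1; last by move=> u /uw ->.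
  apply: (tree_at_K2 P x0C wC) => [|u /uw//].
  have [pC|/uw pw] := boolP (par w \in C).
    by rewrite -rw -(rt_par P) (rt_c P).
  by have := pres_rank P wC; rewrite pw ltnn.
right.
(* The competitor keeps the cycle length and hangs [p] balanced branches at one vertex. For [p = 0]
   there is no bridge, as its sides would contain odd vertices. *)
have [Sle Z0] : S <= star_cut n N p /\ Z = 0.
  have [p0|p0] := posnP p.
    have noC w : (w \notin C) = false.
      apply/negbTE/negP => wC; have [x xo _] := side_odd P n wC.
      by move: p0; rewrite -pE' => /eqP; rewrite cards_eq0 => /eqP e; rewrite e inE in xo.
    by rewrite /S /Z !big_pred0.
  have el : (l - 3).+3 = l by move: l3; clear; lia.
  have := sum_cut_ge P nE; rewrite NE pE' -/S => Sge.
  have := br_in_U (l - 3) p0 pN op; rewrite el nlN.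
  rewrite (_ : n - p = r); last by move: pE; clear; lia.
  move/hmin; rewrite -leq_double => Wle.
  have := leq_trans Wle (br_wiener _ p0 pN op).
  rewrite el nlN WG; move: Sge; clear; lia.
have bal := sum_cut_eq P nE; rewrite NE pE' -/S in bal; have {}bal := bal Sle.
have rt0 u : u \notin C -> rt par h u = x0.
  move=> uC; apply: root_max => // v vC; apply/eqP; apply: contraT => ne.
  have := dcyc_neq (rt_mem P v) (rt_mem P u); rewrite ne.
  by move/eqP: Z0; rewrite sum_nat_eq0 => /forall_inP/(_ v vC);
     rewrite sum_nat_eq0 => /forall_inP/(_ u uC)/eqP ->.
have bal' : forall k, k < n./2 -> above C par n k.+1 = #|[pred x | x \notin C]| - #|oddv G| * k.
  by rewrite NE pE'.
have chain w v : w \notin C -> rt par h w = x0 -> v \notin C -> par v = w ->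
    #|desc par w| = #|desc par v|.+1.
  by move=> wC _; apply: (only_child P nE bal').
set L := branch_lengths C par x0.
have LP t : t \in L -> exists v, [/\ v \notin C, par v = x0 & t = #|desc par v|].
  case/mapP => v; rewrite mem_enum in_set => /andP[vC /eqP pv] ->.
  by exists v.
(* The longest branch gives [t], and [top_ge] leaves only [t] and [t - 1] for the others. Without
   branches the maximum is 0, as in the convention for a single vertex. *)
exists (size L), (\max_(i <- L) i), l.-1, (subdivided_star L); split.
(* By [oddv_ncyc] cycle vertices are even, and the degree of [x0] is the number of branches plus
   2. *)
- have x0odd : ~~ odd (degree x0).
    apply: contraL x0C => ox; apply: (oddv_ncyc P nE bal'); first by rewrite NE pE'.
    by rewrite in_set.
  move: x0odd; rewrite (degreeE P) x0C oddD addbF /L /branch_lengths size_map -cardE.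
  by [].
- exists L; split=> //.
    move=> t tL; have [v [vC pv ->]] := LP t tL; split; first exact: desc_gt0.
    have vL : #|desc par v| \in L by apply: map_f; rewrite mem_enum in_set vC pv eqxx.
    have le1 : #|desc par v| <= \max_(i <- L) i by rewrite (big_rem _ vL) /= leq_maxl.
    have le2 : \max_(i <- L) i <= #|desc par v|.+1.
      apply/bigmax_leqP_seq => i iL _; have [w [wC _ ->]] := LP i iL.
      by apply: (top_ge P nE bal') => //; rewrite pv.
    by move: le1 le2; clear; lia.
  case: (L) => [|t L']; [by right; rewrite big_nil|left].
  elim: L' t => [|t' L' IHL] t; first by rewrite big_seq1 mem_head.
  rewrite big_cons; case: leqP => _; last by rewrite mem_head.
  by rewrite inE IHL orbT.
- by move: l3; clear; lia.
by apply: iso_K1 => //; apply: (tree_at_star P x0C).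
Qed.

End Extremal.

Theorem theorem1p1 (n r : nat) (G : sgraph)
    (hG : in_U n r G)
    (hmin : forall G' : sgraph, in_U n r G' -> wiener G <= wiener G') :
  (r <= 2 ->
     exists (b1 : nat) (X1 X2 : rooted_graph),
       [/\ odd b1,
           X1 = K1 \/ X1 = K2,
           X2 = K1 \/ X2 = K2
         & isomorphic G (H_of [:: SB 1 b1; X1; X2])])
  /\
  (3 <= r ->
     isomorphic G (H_of [:: K2; K1; K1; K1; K1]) \/
     exists (b2 t k : nat) (S : rooted_graph),
       [/\ ~~ odd b2,
           is_SaB t b2 S,
           2 <= k
         & isomorphic G (H_of (S :: nseq k K1))]).
Proof.
split; first exact: extremal_few_even hG hmin.
exact: extremal_many_even hG hmin.
Qed.
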